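(* There exists an absolute constant $C\ge 2$ such that the following holds. Let $d\ge 2$, let $\boldsymbol H\in\mathbb R^{d\times d}$ be a universal sensing basis, let $N,K\ge 1$ and $T\ge 0$ be integers, and let $\delta>0$. Let $f:\mathbb R^d\to\mathbb R$ be convex and differentiable, and let $g(\boldsymbol\xi,\cdot)$ be a stochastic gradient oracle for $f$ with variance bounded by $\sigma^2$ such that, for some $B>0$, $$\|g(\boldsymbol\xi,\boldsymbol x)\|_2\le B\quad\text{for all }\boldsymbol x\in\mathbb R^d.$$ For parameters $\alpha,\alpha^{\rm s}\ge C$, set $$\lambda=\alpha B\sqrt{\tfrac{\log d}{d}},\qquad \lambda^{\rm s}=\alpha^{\rm s}\lambda\sqrt{\log d}.$$ Let $\boldsymbol x_0\in\mathbb R^d$ and let the iterates be given by $$\boldsymbol x_{t+1}=\boldsymbol x_t-\delta\,\boldsymbol v_t,\qquad \boldsymbol v_t=\mathcal L_t^{\rm s}\Big(\tfrac1N\sum_{n=1}^N\mathcal L_{t,n}\big(g(\boldsymbol\xi_{t,n},\boldsymbol x_t)\big)\Big),\qquad t=0,\ldots,T,$$ where the $\boldsymbol\xi_{t,n}$ are independent copies of $\boldsymbol\xi$, the $\mathcal L_{t,n}$ are independent copies of the random $\lambda$-transform $\mathcal Z_{\lambda}=\mathcal Z_{\lambda,1}:\mathbb R^d\to\mathbb R^d$, the $\mathcal L_t^{\rm s}$ are independent copies of the random $(\lambda^{\rm s},K)$-transform $\mathcal Z_{\lambda^{\rm s},K}:\mathbb R^d\to\mathbb R^d$, and all involved random variables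 are independent. Set $\bar{\boldsymbol x}_T=\frac1{T+1}\sum_{t=0}^T\boldsymbol x_t$ and, for $\boldsymbol x_\ast\in\mathbb R^d$, $$\eta_T^*(\boldsymbol x_\ast)=\mathbb E\Big[\tfrac1{T+1}\sum_{t=0}^T\|\boldsymbol x_t-\boldsymbol x_\ast\|_2\Big].$$ Then for any $\boldsymbol x_\ast\in\mathbb R^d$, $$\begin{aligned} \mathbb E[f(\bar{\boldsymbol x}_T)]-f(\boldsymbol x_\ast)\le{}& \mathcal C+\alpha^2B^2\delta\Big(\tfrac{8\log d}{N}+\tfrac{4(\alpha^{\rm s})^2\log^2 d}{K}\Big)\\ &+32B^2\delta\Big(N\exp(-\tfrac18\alpha^2\log d)+\alpha^2\log(d)\exp(-\tfrac18(\alpha^{\rm s})^2\log d)\Big)\\ &+4B\,\eta_T^*(\boldsymbol x_\ast)\Big(N\exp(-\tfrac18\alpha^2\log d)+\alpha\sqrt{\log d}\,\exp(-\tfrac18(\alpha^{\rm s})^2\log d)\Big), \end{aligned}$$ where $$\mathcal C=\tfrac{1}{2(T+1)\delta}\|\boldsymbol x_\ast-\boldsymbol x_0\|_2^2+\tfrac{\delta}{T+1}\sum_{t=0}^T\mathbb E\big[\|\nabla f(\boldsymbol x_t)\|_2^2\big]+\tfrac{2\sigma^2\delta}{N}.$$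
   Context: Stochastic gradient oracle: for a differentiable $f:\mathbb R^d\to\mathbb R$, a function $g:\Omega\times\mathbb R^d\to\mathbb R^d$ and a random variable $\boldsymbol\xi\in\Omega$, $g(\boldsymbol\xi,\cdot)$ is a stochastic gradient oracle for $f$ if $\mathbb E[g(\boldsymbol\xi,\boldsymbol x)]=\nabla f(\boldsymbol x)$ for all $\boldsymbol x\in\mathbb R^d$. Its variance is bounded by $\sigma^2$ if $\mathbb E\big[\|g(\boldsymbol\xi,\boldsymbol x)-\mathbb E[g(\boldsymbol\xi,\boldsymbol x)]\|_2^2\big]\le\sigma^2$ for all $\boldsymbol x\in\mathbb R^d$. Quantizer: for $\lambda>0$ and $K\in\mathbb N$, let $\boldsymbol\tau_1,\ldots,\boldsymbol\tau_K$ be independent and uniformly distributed in $[-\lambda,\lambda]^d$. The $K$-averaged dithered one-bit quantizer is the random map $\mathcal Q_{\lambda,K}(\boldsymbol x)=\frac{\lambda}{K}\sum_{i=1}^K\operatorname{sign}(\boldsymbol x+\boldsymbol\tau_i)$, with sign applied componentwise ($\operatorname{sign}(u)=1$ for $u\ge0$, $-1$ for $u<0$). Universal sensing basis: an orthonormal matrix $\boldsymbol H\in\mathbb R^{d\times d}$ with $|\boldsymbol H_{k,l}|=1/\sqrt d$ for all $k,l$. For $\boldsymbol\varepsilon$ uniformly distributed in $\{-1,1\}^d$, the associated randomized universal sensing basis is $\boldsymbol H_{\boldsymbol\varepsilon}=\boldsymbol H\boldsymbol D_{\boldsymbol\varepsilon}$, where $\boldsymbol D_{\boldsymbol\varepsilon}$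 is the diagonal matrix with diagonal $\boldsymbol\varepsilon$. The basis $\boldsymbol H$ is fixed throughout. $(\lambda,K)$-transform: the random map $\mathcal Z_{\lambda,K}(\boldsymbol x)=\boldsymbol H_{\boldsymbol\varepsilon}^{-1}\mathcal Q_{\lambda,K}(\boldsymbol H_{\boldsymbol\varepsilon}\boldsymbol x)$, where $\boldsymbol\varepsilon$ is independent of $\boldsymbol\tau_1,\ldots,\boldsymbol\tau_K$. For $K=1$ write $\mathcal Z_\lambda=\mathcal Z_{\lambda,1}$ (the $\lambda$-transform). Independent copies of a transform are obtained by drawing independent copies of $(\boldsymbol\varepsilon,\boldsymbol\tau_1,\ldots,\boldsymbol\tau_K)$, with the same $\boldsymbol H$. An absolute constant is one independent of all other parameters; $\log$ is the natural logarithm. *)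

(* Defs.v *)
From HB Require Import structures.
From mathcomp Require Import all_boot all_order all_algebra finmap.
From mathcomp Require Import all_classical all_reals all_analysis.

Set Implicit Arguments.
Unset Strict Implicit.
Unset Printing Implicit Defensive.

Import Order.TTheory GRing.Theory Num.Theory.
Import numFieldNormedType.Exports.

Local Open Scope classical_set_scope.
Local Open Scope ring_scope.

(* Points of R^d are column vectors, with the Borel sigma-algebra of the
   library's topology on matrices (that of the sup norm). *)
Definition mx_borel_display : measure_display. Proof. exact. Qed.

Section mx_borel.
Context (R : realType) (m n : nat).

Definition mx_borel : set (set 'M[R]_(m, n)) := <<s @open 'M[R]_(m, n) >>.

Let mx_borel0 : mx_borel set0.
Proof. exact: sigma_algebra0. Qed.

Let mx_borelC A : mx_borel A -> mx_borel (~` A).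
Proof. exact: sigma_algebraC. Qed.

Let mx_borel_bigcup (F : (set 'M[R]_(m, n))^nat) :
  (forall i, mx_borel (F i)) -> mx_borel (\bigcup_i F i).
Proof. exact: sigma_algebra_bigcup. Qed.

HB.instance Definition _ := @isMeasurable.Build mx_borel_display
  'M[R]_(m, n) mx_borel mx_borel0 mx_borelC mx_borel_bigcup.

End mx_borel.

Section euclidean.
Context {R : realType} {d : nat}.
Implicit Types (x : 'cV[R]_d) (f : 'cV[R]_d -> R).

(* The library norm `|x| on matrices is the sup norm. *)
Definition norm2 x : R := Num.sqrt (\sum_(j < d) x j 0 ^+ 2).

Definition gradient f x : 'cV[R]_d := \col_j 'D_(delta_mx j 0) f x.

End euclidean.

Section oracle.
Context {R : realType} {d : nat}.
Context {dS} {S : measurableType dS} {dX} {X : measurableType dX}.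
Variables (Q : probability S R) (xi : {RV Q >-> X}).
Variable g : X -> 'cV[R]_d -> 'cV[R]_d.

Definition vexpectation (Y : S -> 'cV[R]_d) : 'cV[R]_d :=
  \col_j fine 'E_Q[fun s => Y s j 0%R]%E.

(* The expectation of each coordinate is compared in the extended reals, so
   that the equation forces this coordinate to be integrable. *)
Definition stochastic_gradient_oracle (f : 'cV[R]_d -> R) : Prop :=
  measurable_fun [set: X * 'cV[R]_d] (fun p => g p.1 p.2) /\
  forall x j, 'E_Q[fun s => g (xi s) x j 0%R]%E = (gradient f x j 0)%:E.

Definition variance_bounded (v : R) : Prop :=
  forall x, ('E_Q[fun s =>
    (norm2 (g (xi s) x - vexpectation (fun s' => g (xi s') x)) ^+ 2)%R]
    <= v%:E)%E.

End oracle.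

Section transform.
Context {R : realType} {d : nat}.
Implicit Types (H : 'M[R]_d) (lam : R) (eps x : 'cV[R]_d).

Definition signv x : 'cV[R]_d := \col_j (if 0 <= x j 0 then 1 else -1).

Definition quantizer lam K (tau : 'I_K -> 'cV[R]_d) x : 'cV[R]_d :=
  (lam / K%:R) *: \sum_(i < K) signv (x + tau i).

Definition universal_sensing_basis H : Prop :=
  H *m H^T = 1%:M /\ forall k l, `|H k l| = 1 / Num.sqrt d%:R.

Definition randomized_basis H eps : 'M[R]_d := H *m diag_mx eps^T.

(* The random (lam, K)-transform, as a function of the randomness
   (eps, tau_1, ..., tau_K) it is built from. *)
Definition transform H lam K eps (tau : 'I_K -> 'cV[R]_d) x : 'cV[R]_d :=
  invmx (randomized_basis H eps)
    *m quantizer lam tau (randomized_basis H eps *m x).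

End transform.

Section laws.
Context {R : realType} {dO} {Omega : measurableType dO}.
Variable P : probability Omega R.

Definition uniform_signs d (eps : {RV P >-> 'cV[R]_d}) : Prop :=
  forall s : 'cV[R]_d, (forall j, s j 0 = 1 \/ s j 0 = -1) ->
    P (eps @^-1` [set s]) = ((2 ^+ d)^-1)%:E.

(* The law of tau on R^d is the d-fold product of the uniform distribution on
   [-lam, lam]; for 0 < lam the factors below are [uniform_prob]. *)
Definition uniform_cube d (lam : R) (tau : {RV P >-> 'cV[R]_d}) : Prop :=
  forall A : 'I_d -> set R, (forall j, measurable (A j)) ->
    P [set w | forall j, A j (tau w j 0)] =
    (\prod_(j < d) \int[lebesgue_measure]_(u in A j)
                     (uniform_pdf (- lam) lam u)%:E)%E.

Definition copy_of {dS} {S : measurableType dS} (Q : probability S R)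
    {dX} {X : measurableType dX}
    (xi : {RV Q >-> X}) (xi' : {RV P >-> X}) : Prop :=
  forall A : set X, measurable A -> distribution P xi' A = distribution Q xi A.

Definition mutually_independent (I : choiceType)
    (F : I -> set (set Omega)) : Prop :=
  forall (J : {fset I}) (A : I -> set Omega),
    (forall i, i \in J -> F i (A i)) ->
    P (\bigcap_(i in [set` J]) A i) = (\prod_(i <- J) P (A i))%E.

End laws.

(* The sources of randomness: xi_{t,n}, then (eps, tau) of L_{t,n}, then
   (eps, tau_1, ..., tau_K) of L_t^s. *)
Inductive source (T N K : nat) : Type :=
| Oracle of 'I_T.+1 & 'I_N
| Signs of 'I_T.+1 & 'I_N
| Dither of 'I_T.+1 & 'I_N & 'I_1
| ServerSigns of 'I_T.+1
| ServerDither of 'I_T.+1 & 'I_K.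

HB.instance Definition _ T N K := gen_eqMixin (source T N K).
HB.instance Definition _ T N K := gen_choiceMixin (source T N K).

Section scheme.
Context {R : realType} {dO} {Omega : measurableType dO}.
Variable P : probability Omega R.
Context {dX} {X : measurableType dX} {d T N K : nat}.
Variables
  (xi : 'I_T.+1 -> 'I_N -> {RV P >-> X})
  (eps : 'I_T.+1 -> 'I_N -> {RV P >-> 'cV[R]_d})
  (tau : 'I_T.+1 -> 'I_N -> 'I_1 -> {RV P >-> 'cV[R]_d})
  (eps_s : 'I_T.+1 -> {RV P >-> 'cV[R]_d})
  (tau_s : 'I_T.+1 -> 'I_K -> {RV P >-> 'cV[R]_d}).

Definition source_sigma (i : source T N K) : set (set Omega) :=
  match i with
  | Oracle t n => g_sigma_algebra_preimage (xi t n)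
  | Signs t n => g_sigma_algebra_preimage (eps t n)
  | Dither t n k => g_sigma_algebra_preimage (tau t n k)
  | ServerSigns t => g_sigma_algebra_preimage (eps_s t)
  | ServerDither t k => g_sigma_algebra_preimage (tau_s t k)
  end.

Definition all_independent : Prop := mutually_independent P source_sigma.

Definition descent_direction (H : 'M[R]_d) (lam lam_s : R)
    (g : X -> 'cV[R]_d -> 'cV[R]_d) (t : 'I_T.+1) (w : Omega)
    (y : 'cV[R]_d) : 'cV[R]_d :=
  transform H lam_s (eps_s t w) (fun k => tau_s t k w)
    (N%:R^-1 *: \sum_(n < N)
       transform H lam (eps t n w) (fun k => tau t n k w) (g (xi t n w) y)).

End scheme.

Definition average_iterate {R : realType} {Omega : Type} {d : nat} (T : nat)
    (x : nat -> Omega -> 'cV[R]_d) (w : Omega) : 'cV[R]_d :=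
  T.+1%:R^-1 *: \sum_(t < T.+1) x t w.

(* Main.v *)
Require Import Defs.
From HB Require Import structures.
From mathcomp Require Import all_boot all_order all_algebra finmap.
From mathcomp Require Import all_classical all_reals all_analysis.
From mathcomp Require Import measurable_realfun ring lra.

Set Implicit Arguments.
Unset Strict Implicit.
Unset Printing Implicit Defensive.

Import Order.TTheory GRing.Theory Num.Theory.
Import numFieldNormedType.Exports.

Local Open Scope classical_set_scope.
Local Open Scope ring_scope.

(** In the randomized basis [H D_eps] every coordinate of a vector [y] with
    |y| <= B is a Rademacher sum of variance at most B^2/d, so it exceeds
    lambda = alpha B sqrt(log d / d) with probability at most
    2 exp(- alpha^2 log(d) / 4) (Chernoff bound with cosh x <= exp(x^2)).  A
    dithered sign has mean clip(u), hence is unbiased when nothing is clipped: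
    the lambda-transform is unbiased up to 2 B exp(- alpha^2 log(d) / 8).  Its
    output always has norm lambda sqrt(d) = alpha B sqrt(log d); the same
    estimate thus applies to the server with alpha B sqrt(log d) in place of B.
    For the second moment, clipping is a contraction, so that the server adds at
    most d (lambda^s)^2 / K, and independence of the workers divides their
    contribution alpha^2 B^2 log d by N.  It remains to run the telescoping
    argument for gradient descent with a biased direction, where conditioning on
    the past is an application of Fubini's theorem. *)

(** * Means of bounded measurable functions *)

(** Integrability never has to be discussed, because every integrand is kept bounded at each
    outcome. A transform has output of bounded norm whatever its input, so the iterates stay in
    balls of deterministic radius, on which convexity and the gradient bound control [f]. Two
    properties hold only almost surely and stand in the way: [eps] is a sign vector, and the oracle
    has norm at most [B]. The first is met by using the signs of [eps] and comparing expectations at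
    the end, the second by truncating the oracle where its mean is computed. Conditioning takes the
    form of a function of two outcomes: one outcome is frozen, the other is averaged out. This
    happens on three scales: signs against dither inside a transform, oracle against coding and
    workers against server inside a step, past against present along the trajectory. It explains the
    definitions that take two outcomes. In the tail, the exponent [alpha^2 / 4] of the Chernoff
    bound drops to [alpha^2 / 8] to pay for a factor [d] from the union over coordinates. The
    squared bias is then bounded linearly in the tail, which is at most 1. *)

Definition bounded_measurable {R : realType} {d} {T : measurableType d}
    (f : T -> R) : Prop :=
  measurable_fun [set: T] f /\ exists M, forall x, `|f x| <= M.

Definition mean {R : realType} {d} {T : measurableType d}
    (P : probability T R) (f : T -> R) : R := \int[P]_x f x.

Section bounded_measurable_theory.
Context {R : realType} {d} {T : measurableType d}.
Implicit Types (f g : T -> R).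

Lemma bounded_measurable_cst (c : R) : bounded_measurable (fun _ : T => c).
Proof. by split; [exact: measurable_cst|exists `|c|]. Qed.

Lemma bounded_measurableD f g : bounded_measurable f -> bounded_measurable g ->
  bounded_measurable (fun x => f x + g x).
Proof.
move=> [mf [M fM]] [mg [N gN]]; split; first exact: measurable_funD.
by exists (M + N) => x; rewrite (le_trans (ler_normD _ _))// lerD.
Qed.

Lemma bounded_measurableN f :
  bounded_measurable f -> bounded_measurable (fun x => - f x).
Proof.
move=> [mf [M fM]]; split; first exact: measurableT_comp.
by exists M => x; rewrite normrN.
Qed.

Lemma bounded_measurableB f g : bounded_measurable f -> bounded_measurable g ->
  bounded_measurable (fun x => f x - g x).
Proof. by move=> bf bg; apply/bounded_measurableD/bounded_measurableN. Qed.

Lemma bounded_measurableM f g : bounded_measurable f -> bounded_measurable g ->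
  bounded_measurable (fun x => f x * g x).
Proof.
move=> [mf [M fM]] [mg [N gN]]; split; first exact: measurable_funM.
by exists (M * N) => x; rewrite normrM ler_pM.
Qed.

Lemma bounded_measurable_sum I (s : seq I) (p : pred I) (F : I -> T -> R) :
  (forall i, bounded_measurable (F i)) ->
  bounded_measurable (fun x => \sum_(i <- s | p i) F i x).
Proof.
move=> bF; elim: s => [|i s ih].
  by under eq_fun do rewrite big_nil; exact: bounded_measurable_cst.
under eq_fun do rewrite big_cons; case: (p i) => //.
exact: bounded_measurableD.
Qed.

Variable P : probability T R.

Lemma bounded_measurable_integrable f :
  bounded_measurable f -> P.-integrable setT (EFin \o f).
Proof.
move=> [mf [M fM]]; apply: measurable_bounded_integrable => //.
  by have := @ltry R 1; rewrite -(probability_setT P).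
exists M; split; first exact: num_real.
by move=> N MN x _ /=; rewrite (le_trans (fM x))// ltW.
Qed.

Lemma mean_cst (c : R) : mean P (fun=> c) = c.
Proof.
rewrite /mean Rintegral_cst// (_ : fine _ = 1) ?mulr1//.
by have /(congr1 fine) := probability_setT P.
Qed.

Lemma meanD f g : bounded_measurable f -> bounded_measurable g ->
  mean P (fun x => f x + g x) = mean P f + mean P g.
Proof. by move=> *; rewrite /mean RintegralD//; exact: bounded_measurable_integrable. Qed.

Lemma meanB f g : bounded_measurable f -> bounded_measurable g ->
  mean P (fun x => f x - g x) = mean P f - mean P g.
Proof. by move=> *; rewrite /mean RintegralB//; exact: bounded_measurable_integrable. Qed.

Lemma meanZ f (c : R) : bounded_measurable f ->
  mean P (fun x => c * f x) = c * mean P f.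
Proof. by move=> *; rewrite /mean RintegralZl//; exact: bounded_measurable_integrable. Qed.

Lemma mean_sum I (s : seq I) (p : pred I) (F : I -> T -> R) :
  (forall i, bounded_measurable (F i)) ->
  mean P (fun x => \sum_(i <- s | p i) F i x) = \sum_(i <- s | p i) mean P (F i).
Proof.
move=> bF; elim: s => [|i s ih].
  by under eq_fun do rewrite big_nil; rewrite big_nil mean_cst.
under eq_fun do rewrite big_cons; rewrite big_cons; case: (p i) => //.
by rewrite meanD ?ih//; exact: bounded_measurable_sum.
Qed.

Lemma eq_mean_ae f g : bounded_measurable f -> bounded_measurable g ->
  {ae P, forall x, f x = g x} -> mean P f = mean P g.
Proof.
move=> [mf _] [mg _] fg; rewrite /mean /Rintegral; congr fine.
apply: ae_eq_integral => //; [exact/measurable_EFinP|exact/measurable_EFinP|].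
by apply: filterS fg => x -> .
Qed.

Lemma ler_mean f g : bounded_measurable f -> bounded_measurable g ->
  (forall x, f x <= g x) -> mean P f <= mean P g.
Proof.
move=> bf bg fg; apply: le_Rintegral => //; exact: bounded_measurable_integrable.
Qed.

Lemma ler_mean_ae f g : bounded_measurable f -> bounded_measurable g ->
  {ae P, forall x, f x <= g x} -> mean P f <= mean P g.
Proof.
(* The maximum dominates [f] everywhere and equals [g] almost everywhere, so the pointwise
   comparison applies to it. *)
move=> bf bg fg; have bm : bounded_measurable (fun x => Num.max (f x) (g x)).
  case: bf bg => mf [M fM] [mg [N gN]]; split; first exact: measurable_maxr.
  exists (Num.max M N) => x; rewrite /Num.max; case: ifPn => _;
    by rewrite le_max ?fM ?gN ?orbT.
rewrite -(eq_mean_ae bm bg).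
  by apply: ler_mean => // x; rewrite le_max lexx.
by apply: filterS fg => x /max_idPr.
Qed.

Lemma ler_norm_mean f g : bounded_measurable f -> bounded_measurable g ->
  {ae P, forall x, `|f x| <= g x} -> `|mean P f| <= mean P g.
Proof.
move=> bf bg fg; rewrite ler_norml; apply/andP; split.
  rewrite -subr_ge0 opprK -meanD// -[leLHS](mean_cst 0).
  apply: ler_mean_ae; [exact: bounded_measurable_cst|exact: bounded_measurableD|].
  by apply: filterS fg => x; rewrite ler_norml -lerBlDr sub0r => /andP[].
by apply: ler_mean_ae => //; apply: filterS fg => x; rewrite ler_norml => /andP[].
Qed.

Lemma normr_mean_le f (M : R) : bounded_measurable f ->
  (forall x, `|f x| <= M) -> `|mean P f| <= M.
Proof.
move=> bf fM; rewrite -[leRHS]mean_cst; apply: ler_norm_mean => //.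
  exact: bounded_measurable_cst.
exact: aeW.
Qed.

Lemma expectation_mean f : bounded_measurable f -> 'E_P[f]%E = (mean P f)%:E.
Proof.
move=> bf; rewrite unlock /mean /Rintegral fineK//.
exact/integrable_fin_num/bounded_measurable_integrable.
Qed.

End bounded_measurable_theory.

(** * Expectations of functions that agree almost surely *)

Section null_modification.
Import HBNNSimple.

(* [f] is not assumed measurable: the iterates of the theorem invert a matrix
   built from the sign vectors, and agree only almost surely with the
   measurable process that is analysed. *)
Lemma expectation_null_modification {R : realType} {d} {T : measurableType d}
    (P : probability T R) (E : set T) (f g : T -> R) :
  measurable E -> P (~` E) = 0%E -> (forall x, E x -> f x = g x) ->
  'E_P[f]%E = 'E_P[g]%E.
Proof.
move=> mE PE fg; rewrite unlock.
suff le (u v : T -> \bar R) : (forall x, 0 <= u x)%E -> (forall x, 0 <= v x)%E ->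
    (forall x, E x -> u x = v x) -> (\int[P]_x u x <= \int[P]_x v x)%E.
  have fgp x : E x -> ((EFin \o f)^\+ x = (EFin \o g)^\+ x)%E.
    by move=> Ex; rewrite !funeposE /= fg.
  have fgn x : E x -> ((EFin \o f)^\- x = (EFin \o g)^\- x)%E.
    by move=> Ex; rewrite !funenegE /= fg.
  rewrite integralE [RHS]integralE; congr (_ - _)%E;
    apply/eqP; rewrite eq_le; apply/andP; split; apply: le => // x Ex.
  - exact/esym/fgp.
  - exact/esym/fgn.
(* The integral of a nonnegative function is a supremum over the simple functions below it. Cutting
   such a function [h] to zero outside [E] keeps its integral, since [E] has full measure, and puts
   it below [v]. *)
move=> u0 v0 uv; rewrite !ge0_integralTE//; apply: ge_ereal_sup => _ [h /= hu <-].
have -> : sintegral P h = (\int[P]_x (proj_nnsfun h mE x)%:E)%E.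
  rewrite -integralT_nnsfun; apply: ae_eq_integral => //.
  - exact/measurable_EFinP.
  - exact/measurable_EFinP.
  - exists (~` E); split => //; first exact: measurableC.
    move=> x /= hx Ex; apply: hx => _; congr EFin.
    by rewrite /proj_nnsfun/= mindicE mem_set// mulr1.
rewrite integralT_nnsfun; apply: ereal_sup_ubound; exists (proj_nnsfun h mE) => //= x.
rewrite /proj_nnsfun/= mindicE; have [/set_mem Ex|nE] := boolP (x \in E).
  by rewrite mulr1 -uv.
by rewrite mulr0.
Qed.

End null_modification.

(** * Independence *)

Section independence.
Context {R : realType} {d} {Omega : measurableType d} (P : probability Omega R).
Context (I : choiceType) (F : I -> set (set Omega)).
Hypothesis sF : forall i, sigma_algebra setT (F i).
Hypothesis mF : forall i, F i `<=` measurable.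
Hypothesis indF : mutually_independent P F.
Implicit Types (J : set I) (K : {fset I}).

Definition union_sigma J : set (set Omega) := \bigcup_(i in J) F i.

(** Finite intersections of events from the sources in [J]. They form a pi-system that generates the
    same sigma-algebra as [union_sigma J], and mutual independence speaks about them directly. *)
Let cylinder J : set (set Omega) := [set A | exists K (B : I -> set Omega),
  [/\ forall i, i \in K -> J i, forall i, F i (B i) &
      A = \bigcap_(i in [set` K]) B i]].

Let FT i : F i setT.
Proof. by have [h0 hC _] := sF i; have := hC _ h0; rewrite setD0. Qed.

Let FI i A B : F i A -> F i B -> F i (A `&` B).
Proof.
rewrite -(sigma_algebra_id (sF i)) => hA hB.
exact: (@measurableI _ (g_sigma_algebraType (F i)) A B).
Qed.

Let cylinderT J : cylinder J setT.
Proof.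
exists fset0, (fun=> setT); split => //.
by apply/seteqP; split.
Qed.

Let cylinderI J : setI_closed (cylinder J).
Proof.
move=> _ _ [K1 [B1 [J1 F1 ->]]] [K2 [B2 [J2 F2 ->]]].
exists (K1 `|` K2)%fset, (fun i => (if i \in K1 then B1 i else setT) `&`
  (if i \in K2 then B2 i else setT)); split.
- by move=> i; rewrite in_fsetU => /orP[/J1|/J2].
- by move=> i; apply: FI; case: ifP.
- apply/seteqP; split => [w [h1 h2] i _|w h].
    by split; case: ifP => // iK; [exact: h1|exact: h2].
  split=> i /= iK; have := h i; rewrite /= in_fsetU iK ?orbT => /(_ isT)[//].
Qed.

Let cylinder_measurable J : cylinder J `<=` measurable.
Proof.
move=> _ [K [B [_ FB ->]]]; apply: fin_bigcap_measurable => // i _.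
exact/mF/FB.
Qed.

Let union_cylinder J : union_sigma J `<=` cylinder J.
Proof.
move=> A [i Ji FA]; exists [fset i]%fset, (fun j => if j == i then A else setT).
split.
- by move=> j; rewrite in_fset1 => /eqP ->.
- by move=> j; case: eqP => [->|].
- apply/seteqP; split => [w Aw j /=|w /(_ i)].
    by rewrite in_fset1 => /eqP ->; rewrite eqxx.
  by rewrite /= in_fset1 eqxx => /(_ isT).
Qed.

Let cylinder_independent J1 J2 A1 A2 : J1 `&` J2 = set0 ->
  cylinder J1 A1 -> cylinder J2 A2 -> P (A1 `&` A2) = (P A1 * P A2)%E.
Proof.
move=> J12 [K1 [B1 [hJ1 F1 ->]]] [K2 [B2 [hJ2 F2 ->]]].
have K12 i : i \in K2 -> (i \in K1) = false.
  move=> /hJ2 iJ2; apply/negP => /hJ1 iJ1.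
  by have : (J1 `&` J2) i by []; rewrite J12.
pose B i := if i \in K1 then B1 i else B2 i.
have -> : \bigcap_(i in [set` K1]) B1 i `&` \bigcap_(i in [set` K2]) B2 i =
    \bigcap_(i in [set` (K1 `|` K2)%fset]) B i.
  apply/seteqP; split => [w [h1 h2] i|w h].
    by rewrite /= in_fsetU /B; case: ifPn => [iK _|_ /= iK]; [exact: h1|exact: h2].
  split=> i /= iK; have := h i; rewrite /= in_fsetU iK ?orbT /B ?iK => /(_ isT) //.
  by rewrite K12.
rewrite (indF (J := (K1 `|` K2)%fset)); last by move=> i _; rewrite /B; case: ifP.
rewrite (indF (J := K1)); last by move=> i _.
rewrite (indF (J := K2)); last by move=> i _.
have p12 : perm_eq (K1 `|` K2)%fset (K1 ++ K2).
  apply: uniq_perm => //.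
    rewrite cat_uniq !fset_uniq andbT /=; apply/hasPn => i iK2.
    by apply/negP => iK1; move: (K12 _ iK2); rewrite iK1.
  by move=> i; rewrite in_fsetU mem_cat.
rewrite (perm_big _ p12) big_cat/=; congr (_ * _)%E.
  by apply: eq_big_seq => i iK; rewrite /B iK.
by apply: eq_big_seq => i iK; rewrite /B K12.
Qed.

(** Both sides are finite measures in [A]: the restriction of [P] to [B], and [P] scaled by the
    number [P B]. They agree on a pi-system containing the whole space, hence on the sigma-algebra
    it generates. *)
Let extend_independent J B : measurable B ->
  (forall A, cylinder J A -> P (A `&` B) = (P A * P B)%E) ->
  forall A, <<s cylinder J >> A -> P (A `&` B) = (P A * P B)%E.
Proof.
move=> mB h A sA; have f0 : 0 <= fine (P B) by apply: fine_ge0.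
have -> : P (A `&` B) = mrestr P mB A by [].
rewrite muleC -[P B]fineK ?fin_num_measure//.
have -> : ((fine (P B))%:E * P A = mscale (NngNum f0) P A)%E by [].
apply: (@g_sigma_algebra_measure_unique _ _ _ (cylinder J) _ (fun=> setT)) => //=.
- exact: bigcup_const.
- move=> A' cA; rewrite /mrestr /mscale/= h// muleC fineK// fin_num_measure//.
- by move=> _; rewrite /mrestr setTI ltey_eq fin_num_measure.
Qed.

(** The extension from cylinders is made twice: in [A1] for an arbitrary fixed [A2], which leaves a
    cylinder in place of [A1], and then in [A2]. *)
Lemma union_sigma_independent J1 J2 A1 A2 : J1 `&` J2 = set0 ->
  <<s union_sigma J1 >> A1 -> <<s union_sigma J2 >> A2 ->
  P (A1 `&` A2) = (P A1 * P A2)%E.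
Proof.
move=> J12 s1 s2.
have {}s1 : <<s cylinder J1 >> A1 by move: s1; apply: sub_sigma_algebra2; exact: union_cylinder.
have {}s2 : <<s cylinder J2 >> A2 by move: s2; apply: sub_sigma_algebra2; exact: union_cylinder.
have mA2 : measurable A2.
  by apply: smallest_sub s2; [exact: sigma_algebra_measurable|exact: cylinder_measurable].
apply: extend_independent s1 => // {}A1 c1.
rewrite setIC muleC; apply: extend_independent s2 => //; first exact: cylinder_measurable c1.
by move=> {mA2} A2 c2; rewrite setIC muleC; exact: (cylinder_independent J12 c1 c2).
Qed.

Lemma union_sigma_measurable J : <<s union_sigma J >> `<=` measurable.
Proof.
by apply: smallest_sub; [exact: sigma_algebra_measurable|move=> A [i _]; exact: mF].
Qed.

Lemma measurable_union_sigma J {d'} {T : measurableType d'} (f : Omega -> T) :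
  measurable_fun [set: g_sigma_algebraType (union_sigma J)] f ->
  measurable_fun [set: Omega] f.
Proof. move=> mf _ A mA; exact: (@union_sigma_measurable J _ (mf measurableT A mA)). Qed.

Lemma sub_union_sigma J1 J2 {d'} {T : measurableType d'} (f : Omega -> T) :
  J1 `<=` J2 ->
  measurable_fun [set: g_sigma_algebraType (union_sigma J1)] f ->
  measurable_fun [set: g_sigma_algebraType (union_sigma J2)] f.
Proof.
move=> J12 mf _ A mA; have := mf measurableT A mA.
by apply: sub_sigma_algebra2; apply: bigcup_subset.
Qed.

Lemma measurable_union_sigma1 J i {d'} {T : measurableType d'} (f : Omega -> T) :
  J i -> (forall A, measurable A -> F i (f @^-1` A)) ->
  measurable_fun [set: g_sigma_algebraType (union_sigma J)] f.
Proof.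
move=> Ji fF _ A mA; apply: sub_sigma_algebra; rewrite setTI.
by exists i => //; exact: fF.
Qed.

(* The two occurrences of [w] are seen through the sigma-algebras of disjoint
   sets of sources, so that the law of [(w, w)] on the product of the two
   measurable spaces is the product measure. *)
Lemma freezing J1 J2 (phi : Omega -> Omega -> R) : J1 `&` J2 = set0 ->
  bounded_measurable (fun p : g_sigma_algebraType (union_sigma J1) *
    g_sigma_algebraType (union_sigma J2) => phi p.1 p.2) ->
  bounded_measurable (fun w => mean P (phi w)) /\
  mean P (fun w => phi w w) = mean P (fun w => mean P (phi w)).
Proof.
set T1 := g_sigma_algebraType _; set T2 := g_sigma_algebraType _.
move=> J12 bphi; have [mphi [M phiM]] := bphi.
have m1 : measurable_fun [set: Omega] (id : Omega -> T1).
  by move=> _ A mA; rewrite setTI; exact: union_sigma_measurable mA.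
have m2 : measurable_fun [set: Omega] (id : Omega -> T2).
  by move=> _ A mA; rewrite setTI; exact: union_sigma_measurable mA.
pose X1 : {mfun Omega >-> T1} := mfun_Sub (mem_set m1).
pose X2 : {mfun Omega >-> T2} := mfun_Sub (mem_set m2).
pose X12 : {mfun Omega >-> (T1 * T2)%type} :=
  mfun_Sub (mem_set (measurable_fun_pair m1 m2)).
pose f (p : T1 * T2) := (phi p.1 p.2)%:E.
have mf : measurable_fun setT f by exact/measurable_EFinP.
have bphi1 w : bounded_measurable (phi w).
  split; last by exists M => w'; exact: (phiM (w, w')).
  apply: (@measurable_union_sigma J2).
  exact: measurableT_comp mphi (@pair1_measurable _ _ T1 T2 w).
have bphid : bounded_measurable (fun w => phi w w).
  split; last by exists M => w; exact: (phiM (w, w)).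
  exact: (measurableT_comp mphi (measurable_fun_pair m1 m2)).
have intf : (distribution P X1 \x distribution P X2)%E.-integrable setT f.
  by apply: bounded_measurable_integrable; split => //; exists M.
have innerE w : (\int[distribution P X2]_y f (w, y))%E = (mean P (phi w))%:E.
  rewrite integral_distribution.
  - rewrite -expectation_mean// unlock//.
  - exact: measurableT_comp mf (@pair1_measurable _ _ T1 T2 w).
  - exact: (bounded_measurable_integrable _ (bphi1 w)).
have FE : fubini_F (distribution P X2) f = fun w => (mean P (phi w))%:E.
  by apply/funext => w; exact: innerE.
have bm1 : measurable_fun [set: T1] (fun w => mean P (phi w)).
  by apply/measurable_EFinP; have := measurable_fubini_F intf; rewrite FE.
have bm : bounded_measurable (fun w => mean P (phi w)).
  split; first exact: measurable_union_sigma bm1.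
  exists M => w; apply: normr_mean_le => //.
  by move=> w'; exact: (phiM (w, w')).
split=> //; apply/EFin_inj; rewrite -!expectation_mean// unlock.
transitivity (\int[distribution P X12]_p f p)%E.
  rewrite integral_distribution//; exact: bounded_measurable_integrable.
transitivity (\int[distribution P X1 \x distribution P X2]_p f p)%E.
  apply: eq_measure_integral => A mA _; apply/esym.
  apply: product_measure_unique => // B C mB mC.
  exact: (union_sigma_independent J12 mB mC).
rewrite -integral12_prod_meas1// FE integral_distribution//.
  exact/measurable_EFinP.
exact: bounded_measurable_integrable.
Qed.

(** The case [phi w w' = f w * g w'] of freezing: the inner mean takes out the constant [f w]. *)
Lemma mean_independentM J1 J2 (f g : Omega -> R) : J1 `&` J2 = set0 ->
  @bounded_measurable R _ (g_sigma_algebraType (union_sigma J1)) f ->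
  @bounded_measurable R _ (g_sigma_algebraType (union_sigma J2)) g ->
  mean P (fun w => f w * g w) = mean P f * mean P g.
Proof.
pose T1 := g_sigma_algebraType (union_sigma J1).
pose T2 := g_sigma_algebraType (union_sigma J2).
move=> J12 [mf [M fM]] [mg [N gN]].
have bf : @bounded_measurable R _ Omega f.
  by split; [exact: measurable_union_sigma mf|exists M].
have bg : @bounded_measurable R _ Omega g.
  by split; [exact: measurable_union_sigma mg|exists N].
have bb : bounded_measurable (fun p : T1 * T2 => f p.1 * g p.2).
  apply: bounded_measurableM.
    split; last by exists M => p; exact: fM.
    exact: (measurableT_comp mf (@measurable_fst _ _ T1 T2)).
  split; last by exists N => p; exact: gN.
  exact: (measurableT_comp mg (@measurable_snd _ _ T1 T2)).
have [_ ->] := freezing (phi := fun w w' => f w * g w') J12 bb.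
under eq_fun do rewrite meanZ//.
by under eq_fun do rewrite mulrC; rewrite meanZ// mulrC.
Qed.

End independence.

(** * Borel measurability of vectors *)

Section mx_measurable.
Context {R : realType}.

Lemma continuous_mx_measurable m n (f : 'M[R]_(m, n) -> R) :
  continuous f -> measurable_fun [set: 'M[R]_(m, n)] f.
Proof.
move=> /continuousP cf; apply: (measurability _ (RGenOpens.measurableE R)).
move=> _ [_ [a [b ->] <-]]; rewrite setTI; apply: sub_sigma_algebra.
exact/cf/interval_open.
Qed.

Lemma measurable_coord m n i j :
  measurable_fun [set: 'M[R]_(m, n)] (fun M => M i j).
Proof. by apply: continuous_mx_measurable; exact: coord_continuous. Qed.

(** The sigma-algebra is generated by all open sets, so coordinatewise measurability needs an
    argument by separability: an open set is a countable union of boxes with rational centres, and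
    the preimage of a box is a finite intersection of conditions on single coordinates. *)
Lemma measurable_mx m n {d} {T : measurableType d} (h : T -> 'M[R]_(m, n)) :
  (forall i j, measurable_fun [set: T] (fun a => h a i j)) ->
  measurable_fun [set: T] h.
Proof.
move=> mh; apply: (@measurability _ _ _ _ _ _ (@open 'M[R]_(m, n))) => //.
move=> _ [U oU <-]; rewrite setTI.
pose V (p : 'M[rat]_(m, n) * nat) : set 'M[R]_(m, n) :=
  [set M | forall i j, `|ratr (p.1 i j) - M i j| < p.2.+1%:R^-1].
(* Boxes not contained in [U] are replaced by the empty set, so that the union runs over a fixed
   countable type. *)
pose V' p := if `[< V p `<=` U >] then h @^-1` V p else set0.
have -> : h @^-1` U = \bigcup_p V' p.
  apply/seteqP; split => [a Ua|a [p _]]; last first.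
    by rewrite /V'; case: asboolP => // VU /VU.
  have : nbhs (h a) U by apply: open_nbhs_nbhs; split.
  (* A radius below [e / 2] suffices: the rational centre is that close to [h a], and every point of
     the box is that close to the centre. *)
  move=> /nbhs_ballP[e /= e0 Ue]; have e20 : 0 < e / 2 by rewrite divr_gt0.
  have [k _ /(_ k (leqnn k)) /= ke] := near_infty_natSinv_lt (PosNum e20).
  have q_ i j : {q : rat | `|ratr q - h a i j| < k.+1%:R^-1}.
    apply: cid; have : h a i j - k.+1%:R^-1 < h a i j + k.+1%:R^-1.
      by rewrite ltrBlDr -addrA ltrDl addr_gt0// invr_gt0.
    move=> /rat_in_itvoo[q]; rewrite in_itv/= => hq; exists q.
    by rewrite ltr_distl.
  exists (\matrix_(i, j) sval (q_ i j), k) => //; rewrite /V'.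
  case: asboolP => [_ i j /=|[]].
    by rewrite mxE; case: (q_ i j).
  move=> M VM; apply: Ue; split => // i j.
  have /= := VM i j; rewrite mxE; case: (q_ i j) => q /= hq hM.
  rewrite /ball/= distrC (splitr e) (le_lt_trans (ler_distD (ratr q) _ _))//.
  by rewrite ltrD// ?(lt_trans hq)// distrC (lt_trans hM).
have mV p : measurable (h @^-1` V p).
  have -> : h @^-1` V p =
      \bigcap_(ij in [set: 'I_m * 'I_n])
        (fun a => `|ratr (p.1 ij.1 ij.2) - h a ij.1 ij.2|) @^-1` `]-oo, p.2.+1%:R^-1[.
    apply/seteqP; split => [a Va [i j] _ /=|a Va i j]; first by rewrite in_itv/=.
    by have := Va (i, j) I; rewrite /= in_itv.
  apply: fin_bigcap_measurable => [|[i j] _]; first exact: finite_finset.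
  rewrite -[X in measurable X]setTI.
  apply: (_ : measurable_fun setT _) => //.
  apply: measurableT_comp => //; apply: measurable_funB => //.
apply: countable_bigcupT_measurable => [|p]; first exact: countableP.
by rewrite /V'; case: ifP.
Qed.

End mx_measurable.

(** * Euclidean geometry and the randomized basis *)

Section dot.
Context {R : realType} {d : nat}.
Implicit Types (x y z c : 'cV[R]_d) (a : R).

Definition dot x y : R := \sum_(j < d) x j 0 * y j 0.

Lemma dotC x y : dot x y = dot y x.
Proof. by apply: eq_bigr => j _; rewrite mulrC. Qed.

Lemma dotDl x y z : dot (x + y) z = dot x z + dot y z.
Proof. by rewrite -big_split; apply: eq_bigr => j _; rewrite mxE mulrDl. Qed.

Lemma dotNl x z : dot (- x) z = - dot x z.
Proof. by rewrite -sumrN; apply: eq_bigr => j _; rewrite mxE mulNr. Qed.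

Lemma dotBl x y z : dot (x - y) z = dot x z - dot y z.
Proof. by rewrite dotDl dotNl. Qed.

Lemma dotBr x y z : dot x (y - z) = dot x y - dot x z.
Proof. by rewrite dotC dotBl !(dotC x). Qed.

Lemma dotZl a x z : dot (a *: x) z = a * dot x z.
Proof. by rewrite mulr_sumr; apply: eq_bigr => j _; rewrite mxE mulrA. Qed.

Lemma dotZr a x z : dot x (a *: z) = a * dot x z.
Proof. by rewrite dotC dotZl dotC. Qed.

Lemma dot_suml I (s : seq I) (F : I -> 'cV[R]_d) z :
  dot (\sum_(i <- s) F i) z = \sum_(i <- s) dot (F i) z.
Proof.
rewrite /dot exchange_big/=; apply: eq_bigr => j _.
by rewrite summxE mulr_suml.
Qed.

Lemma norm2_ge0 x : 0 <= norm2 x. Proof. exact: sqrtr_ge0. Qed.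

Lemma norm2_sqr x : norm2 x ^+ 2 = dot x x.
Proof. by rewrite sqr_sqrtr// sumr_ge0// => j _; rewrite sqr_ge0. Qed.

Lemma dot_ge0 x : 0 <= dot x x. Proof. by rewrite -norm2_sqr sqr_ge0. Qed.

Lemma norm2N x : norm2 (- x) = norm2 x.
Proof. by congr Num.sqrt; apply: eq_bigr => j _; rewrite mxE sqrrN. Qed.

Lemma dot_le2 x y : dot x y <= (dot x x + dot y y) / 2.
Proof.
have : 0 <= dot (x - y) (x - y) by exact: dot_ge0.
rewrite dotBl !dotBr (dotC y x); lra.
Qed.

Lemma norm2_eq0 x : norm2 x = 0 -> x = 0.
Proof.
move=> /(congr1 (fun u => u ^+ 2)); rewrite norm2_sqr expr0n/= => h.
apply/colP => j; rewrite mxE; apply/eqP; rewrite -sqrf_eq0 expr2; apply/eqP.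
by move: h => /psumr_eq0P -> // i _; rewrite -expr2 sqr_ge0.
Qed.

Lemma dot0l x : dot 0 x = 0.
Proof. by rewrite /dot big1// => j _; rewrite mxE mul0r. Qed.

Lemma dot_le_norm2 x y : dot x y <= norm2 x * norm2 y.
Proof.
have [/norm2_eq0 ->|x0] := eqVneq (norm2 x) 0.
  by rewrite dot0l mulr_ge0 ?norm2_ge0.
have [/norm2_eq0 ->|y0] := eqVneq (norm2 y) 0.
  by rewrite dotC dot0l mulr_ge0 ?norm2_ge0.
have := dot_ge0 (norm2 y *: x - norm2 x *: y).
rewrite dotBl !dotBr !dotZl !dotZr -!norm2_sqr (dotC y x).
have : 0 < norm2 x * norm2 y by rewrite mulr_gt0// lt_def ?x0 ?y0 norm2_ge0.
move: (norm2 x) (norm2 y) (dot x y) => a b u ab.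
rewrite (_ : b * (b * a ^+ 2) - b * (a * u) - (a * (b * u) - a * (a * b ^+ 2)) =
  (a * b) * (2 * (a * b - u))); last by ring.
by rewrite pmulr_rge0// pmulr_rge0// subr_ge0.
Qed.

Lemma normr_dot_le x y : `|dot x y| <= norm2 x * norm2 y.
Proof.
rewrite ler_norml dot_le_norm2 andbT lerNl -dotNl -[in leRHS]norm2N.
exact: dot_le_norm2.
Qed.

(** Duality, tested at [c := x]. It turns estimates of means of scalar products, the only means that
    are computed, into norm bounds for mean vectors. *)
Lemma norm2_le b x : 0 <= b -> (forall c, dot x c <= b * norm2 c) -> norm2 x <= b.
Proof.
move=> b0 /(_ x); rewrite -norm2_sqr expr2.
have [->//|x0] := eqVneq (norm2 x) 0.
by rewrite ler_pM2r// lt_def x0 norm2_ge0.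
Qed.

Lemma dot_sqrD_le x y : dot (x + y) (x + y) <= 2 * dot x x + 2 * dot y y.
Proof.
have := dot_ge0 (x - y).
rewrite dotBl !dotBr dotDl !(dotC _ (x + y)) !dotDl (dotC y x); lra.
Qed.

Lemma coord_le_norm2 x j : `|x j 0| <= norm2 x.
Proof.
rewrite -sqrtr_sqr ler_sqrt ?sumr_ge0// => [|i _]; last exact: sqr_ge0.
by rewrite (bigD1 j)//= lerDl sumr_ge0// => i _; exact: sqr_ge0.
Qed.

Lemma dot_mulmx (A : 'M[R]_d) x y : dot (A *m x) y = dot x (A^T *m y).
Proof.
have E u v : dot u v = (u^T *m v) 0 0.
  by rewrite mxE; apply: eq_bigr => j _; rewrite mxE.
by rewrite !E trmx_mul mulmxA.
Qed.

End dot.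

(** * The randomized basis as an isometry *)

Section rotation.
Context {R : realType} {d : nat} (H : 'M[R]_d).
Hypothesis HHT : H *m H^T = 1%:M.
Implicit Types (e x c : 'cV[R]_d).

Definition sign_diag e : 'M[R]_d := diag_mx (signv e)^T.

Lemma sign_diagK e : sign_diag e *m sign_diag e = 1%:M.
Proof.
rewrite /sign_diag mulmx_diag -diag_const_mx; congr diag_mx; apply/rowP => j.
by rewrite !mxE; case: ifP => _; rewrite ?mulr1// mulrNN mulr1.
Qed.

Lemma sign_diagT e : (sign_diag e)^T = sign_diag e.
Proof. exact: tr_diag_mx. Qed.

Definition rotate e x : 'cV[R]_d := H *m (sign_diag e *m x).

Definition rotate_back e x : 'cV[R]_d := sign_diag e *m (H^T *m x).

Lemma dot_rotate_back e x c : dot (rotate_back e x) c = dot x (rotate e c).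
Proof. by rewrite !dot_mulmx trmxK sign_diagT. Qed.

Lemma rotate_backK e : cancel (rotate e) (rotate_back e).
Proof.
move=> x; rewrite /rotate_back /rotate [H^T *m _]mulmxA (mulmx1C HHT) mul1mx.
by rewrite mulmxA sign_diagK mul1mx.
Qed.

Lemma rotateK e : cancel (rotate_back e) (rotate e).
Proof.
move=> x; rewrite /rotate_back /rotate [sign_diag e *m _]mulmxA sign_diagK mul1mx.
by rewrite mulmxA HHT mul1mx.
Qed.

Lemma norm2_rotate e c : norm2 (rotate e c) = norm2 c.
Proof.
apply: (@pexpIrn _ 2); rewrite ?nnegrE ?norm2_ge0// !norm2_sqr.
by rewrite -dot_rotate_back rotate_backK.
Qed.

Lemma norm2_rotate_back e c : norm2 (rotate_back e c) = norm2 c.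
Proof. by rewrite -[in RHS](rotateK e c) norm2_rotate. Qed.

(* [transform] with the signs of [e] in place of [e], so that the basis is
   orthogonal for every outcome. *)
Definition sign_transform lam K e (tau : 'I_K -> 'cV[R]_d) x : 'cV[R]_d :=
  rotate_back e (quantizer lam tau (rotate e x)).

Lemma transformE lam K e (tau : 'I_K -> 'cV[R]_d) x :
  (forall j, e j 0 = 1 \/ e j 0 = -1) ->
  transform H lam e tau x = sign_transform lam e tau x.
Proof.
move=> he; rewrite /transform; have -> : randomized_basis H e = H *m sign_diag e.
  congr (_ *m diag_mx _); apply/rowP => j; rewrite !mxE.
  by case: (he j) => ->; rewrite ?ler01// ler0N1.
have iE : (sign_diag e *m H^T) *m (H *m sign_diag e) = 1%:M.
  by rewrite mulmxA -(mulmxA _ H^T) (mulmx1C HHT) mulmx1 sign_diagK.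
have u : H *m sign_diag e \in unitmx.
  by have /mulmx1_unit[] := iE.
have -> : invmx (H *m sign_diag e) = sign_diag e *m H^T.
  by rewrite -[LHS]mul1mx -iE -(mulmxA _ _ (invmx _)) mulmxV// mulmx1.
by rewrite /sign_transform /rotate_back /rotate !mulmxA.
Qed.

Lemma dot_quantizer lam K (tau : 'I_K -> 'cV[R]_d) x c :
  dot (quantizer lam tau x) c =
  lam / K%:R * \sum_(i < K) \sum_(k < d) signv (x + tau i) k 0 * c k 0.
Proof. by rewrite dotZl dot_suml. Qed.

Lemma dot_signv x : dot (signv x) (signv x) = d%:R.
Proof.
rewrite /dot (eq_bigr (fun=> 1)); first by rewrite sumr_const card_ord.
by move=> j _; rewrite mxE; case: ifP => _; rewrite ?mulr1// mulrNN mulr1.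
Qed.

Lemma norm2_signv x : norm2 (signv x) = Num.sqrt d%:R.
Proof. by rewrite -(dot_signv x) -norm2_sqr sqrtr_sqr ger0_norm ?norm2_ge0. Qed.

Lemma norm2_quantizer lam K (tau : 'I_K -> 'cV[R]_d) x : 0 <= lam -> (0 < K)%N ->
  norm2 (quantizer lam tau x) <= lam * Num.sqrt d%:R.
Proof.
move=> lam0 K0; apply: norm2_le => [|c]; first by rewrite mulr_ge0 ?sqrtr_ge0.
have K0' : (0 : R) < K%:R by rewrite ltr0n.
rewrite dotZl dot_suml -!mulrA ler_wpM2l// ler_pdivrMl//.
apply: le_trans (_ : \sum_(i < K) Num.sqrt d%:R * norm2 c <= _).
  by apply: ler_sum => i _; rewrite (le_trans (dot_le_norm2 _ _))// norm2_signv.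
by rewrite sumr_const card_ord mulr_natl.
Qed.

Lemma norm2_quantizer1 lam (tau : 'I_1 -> 'cV[R]_d) x : 0 <= lam ->
  norm2 (quantizer lam tau x) = lam * Num.sqrt d%:R.
Proof.
move=> lam0; rewrite /quantizer big_ord1 divr1.
apply: (@pexpIrn _ 2); rewrite ?nnegrE ?norm2_ge0 ?mulr_ge0 ?sqrtr_ge0//.
by rewrite norm2_sqr dotZl dotZr dot_signv exprMn sqr_sqrtr// mulrA -expr2.
Qed.

End rotation.

(** * Random signs *)

Section rademacher.
Context {R : realType}.

(** The sharp exponent is [x^2 / 2]; the cruder [x^2] costs only a factor in the exponent and
    follows from [1 + u <= expR u] alone. For [x >= 1] it is immediate from [x <= x^2], which leaves
    [0 <= x < 1]. *)
Lemma expR_pair_le (x : R) : expR x + expR (- x) <= 2 * expR (x ^+ 2).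
Proof.
wlog x0 : x / 0 <= x.
  move=> h; have [/h//|xlt0] := leP 0 x.
  by have := h (- x); rewrite opprK sqrrN addrC; apply; rewrite oppr_ge0 ltW.
have [x1|x1] := leP 1 x.
  have le1 : expR x <= expR (x ^+ 2) by rewrite ler_expR expr2 ler_peMr.
  have le2 : expR (- x) <= expR x by rewrite ler_expR; lra.
  by rewrite mulr_natl mulr2n lerD// (le_trans le2).
(* Both exponentials are compared with [(1 -+ x / 2) ^- 2]. *)
pose v := x ^+ 2 / 4.
have v0 : 0 <= v by rewrite divr_ge0// sqr_ge0.
have v1 : v <= 1 / 4 by rewrite /v; nra.
have e2 (u : R) : expR u = (expR (- (u / 2)) ^+ 2)^-1.
  rewrite -expRM_natl -expRN; congr expR; lra.
have h1 : expR x <= ((1 - x / 2) ^+ 2)^-1.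
  rewrite e2 lef_pV2 ?posrE ?exprn_gt0 ?expR_gt0//; last lra.
  rewrite lerXn2r ?nnegrE ?expR_ge0//; first lra.
  by have := expR_ge1Dx (- (x / 2)); lra.
have h2 : expR (- x) <= ((1 + x / 2) ^+ 2)^-1.
  rewrite e2 lef_pV2 ?posrE ?exprn_gt0 ?expR_gt0//; last lra.
  rewrite lerXn2r ?nnegrE ?expR_ge0//; first lra.
  by have := expR_ge1Dx (- (- x / 2)); lra.
(* The left side is the mean of the bounds in [h1] and [h2], and [4 * v = x^2]. The exponent is
   split as [v + 3v/2 + 3v/2]: one part dominates [1 + v], and each of the others dominates
   [(1 - v)^-1], because [(1 - v) * (1 + 3v/2) >= 1] for [0 <= v <= 1/3]. *)
have h3 : (1 + v) / (1 - v) ^+ 2 <= expR (4 * v).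
  have -> : 4 * v = v + 3 / 2 * v + 3 / 2 * v by lra.
  have ev := expR_ge1Dx v.
  have : expR (- (3 / 2 * v)) <= 1 - v.
    rewrite expRN -[leRHS]invrK lef_pV2 ?posrE ?expR_gt0 ?invr_gt0//; last lra.
    apply: le_trans (expR_ge1Dx _); rewrite -[leLHS]div1r ler_pdivrMr; last lra.
    nra.
  rewrite expRN => ew; rewrite !expRD.
  have w0 := expR_gt0 (3 / 2 * v).
  have {}ew : (1 - v)^-1 <= expR (3 / 2 * v).
    by rewrite -[leRHS]invrK lef_pV2 ?posrE ?invr_gt0//; lra.
  rewrite expr2 invfM mulrA.
  have u0 : 0 <= (1 - v)^-1 by rewrite invr_ge0; lra.
  rewrite ler_pM ?mulr_ge0//; first lra.
  by rewrite ler_pM//; lra.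
have {h3} : (1 + v) / (1 - v) ^+ 2 <= expR (x ^+ 2).
  by have -> : x ^+ 2 = 4 * v by rewrite /v; lra.
suff -> : (1 + v) / (1 - v) ^+ 2 =
    (((1 - x / 2) ^+ 2)^-1 + ((1 + x / 2) ^+ 2)^-1) / 2 by lra.
rewrite /v; field; rewrite !gt_eqF//; [nra|lra|lra].
Qed.

(** The sum over all sign patterns of a product over coordinates is the product of the two-term
    sums, and each of these is a case of [expR_pair_le]. *)
Lemma sum_rademacher_expR d (a : 'I_d -> R) :
  \sum_(b : {ffun 'I_d -> bool})
    expR (\sum_l a l * (if b l then 1 else -1)) <=
  2 ^+ d * expR (\sum_l a l ^+ 2).
Proof.
under eq_bigr do rewrite expR_sum.
rewrite -(bigA_distr_bigA (fun l (c : bool) => expR (a l * (if c then 1 else -1))))/=.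
rewrite expR_sum.
have -> : 2 ^+ d = \prod_(l < d) (2 : R) by rewrite prodr_const card_ord.
rewrite -big_split/=; apply: ler_prod => l _; apply/andP; split.
  by apply: sumr_ge0 => c _; exact: expR_ge0.
by rewrite big_bool/= mulr1 mulrN1 expR_pair_le.
Qed.

End rademacher.

Section signs.
Context {R : realType} {dO} {Omega : measurableType dO} (P : probability Omega R).

Lemma bounded_measurable_indic (A : set Omega) :
  measurable A -> bounded_measurable (\1_A : Omega -> R).
Proof.
move=> mA; split; first exact: measurable_indic.
by exists 1 => w; rewrite indicE; case: (_ \in _); rewrite ?normr1 ?normr0.
Qed.

Lemma mean_indic (A : set Omega) : measurable A -> mean P \1_A = fine (P A).
Proof.
move=> mA; apply: EFin_inj; rewrite -expectation_mean; last exact: bounded_measurable_indic.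
by rewrite expectation_indic// fineK// fin_num_measure.
Qed.

Context {d : nat} (eps : {RV P >-> 'cV[R]_d}).
Hypothesis eps_uniform : uniform_signs eps.

Definition sign_vector (b : {ffun 'I_d -> bool}) : 'cV[R]_d :=
  \col_l (if b l then 1 else -1).

Let meps l : measurable_fun [set: Omega] (fun w => eps w l 0).
Proof. exact: (measurableT_comp (measurable_coord l 0)). Qed.

Lemma measurable_sign_event s : measurable (eps @^-1` [set s]).
Proof.
have -> : eps @^-1` [set s] =
    \bigcap_(l in [set: 'I_d]) (fun w => eps w l 0) @^-1` [set s l 0].
  apply/seteqP; split => [w /= <- l//|w h].
  by apply/colP => l; exact: h.
apply: fin_bigcap_measurable => [|l _]; first exact: finite_finset.
rewrite -[X in measurable X]setTI; exact: (meps l).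
Qed.

(** The pattern is read off from the inequality [0 <= eps w l 0] and not from the value of [eps], so
    that these events partition all of [Omega], including the null set where [eps] is not a sign
    vector. *)
Let event (b : {ffun 'I_d -> bool}) : set Omega :=
  \bigcap_(l in [set: 'I_d]) (fun w => 0 <= eps w l 0) @^-1` [set b l].

Let mevent b : measurable (event b).
Proof.
apply: fin_bigcap_measurable => [|l _]; first exact: finite_finset.
rewrite -[X in measurable X]setTI.
suff : measurable_fun [set: Omega] (fun w => 0 <= eps w l 0) by exact.
exact: measurable_fun_ler.
Qed.

Let event_indic b w :
  (\1_(event b) w : R) = (b == [ffun l => 0 <= eps w l 0])%:R.
Proof.
rewrite indicE; congr (nat_of_bool _)%:R; apply/idP/eqP => [/set_mem h|->].
  by apply/ffunP => l; rewrite ffunE; apply/esym; exact: h.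
by apply/mem_set => l _ /=; rewrite ffunE.
Qed.

Let sign_decomposition (phi : 'cV[R]_d -> R) w : phi (signv (eps w)) =
  \sum_b phi (sign_vector b) * \1_(event b) w.
Proof.
rewrite (bigD1 [ffun l => 0 <= eps w l 0])//= event_indic eqxx mulr1 big1 => [|b].
  by rewrite addr0; congr phi; apply/colP => l; rewrite !mxE ffunE.
by rewrite event_indic => /negPf ->; rewrite mulr0.
Qed.

(** Each event contains the atom where [eps] equals the corresponding sign vector, so its mass is at
    least [2^-d]. There are [2^d] events and their masses add up to 1, which forces equality. *)
Let mean_event b : mean P \1_(event b) = (2 ^+ d)^-1.
Proof.
have ge c : (2 ^+ d)^-1 <= mean P \1_(event c).
  rewrite mean_indic// -lee_fin fineK ?fin_num_measure//.
  rewrite -(@eps_uniform (sign_vector c)); last first.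
    by move=> j; rewrite mxE; case: (c j); [left|right].
  apply: le_measure; rewrite ?inE//; first exact: measurable_sign_event.
  move=> w wc l _ /=; have -> : eps w l 0 = sign_vector c l 0 by rewrite -wc.
  rewrite mxE; case: (c l); first by rewrite ler01.
  by rewrite ler0N1.
have sum1 : \sum_c mean P \1_(event c) = 1.
  rewrite -mean_sum => [|c]; last exact: bounded_measurable_indic.
  rewrite -[RHS](mean_cst P); congr mean; apply/funext => w.
  rewrite [RHS](sign_decomposition (fun=> 1) w).
  by apply: eq_bigr => c _; rewrite mul1r.
apply/le_anti; rewrite ge andbT.
rewrite -(lerD2r (\sum_(c | c != b) (2 ^+ d)^-1)).
have -> : (2 ^+ d)^-1 + \sum_(c | c != b) (2 ^+ d)^-1 = 1 :> R.
  transitivity (\sum_(c : {ffun 'I_d -> bool}) (2 ^+ d)^-1 : R).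
    by rewrite [RHS](bigD1 b).
  rewrite sumr_const card_ffun card_bool card_ord -[LHS]mulr_natl natrX divff//.
by rewrite -[leRHS]sum1 [leRHS](bigD1 b)//= lerD2l ler_sum.
Qed.

Lemma bounded_measurable_signs (phi : 'cV[R]_d -> R) :
  bounded_measurable (fun w => phi (signv (eps w))).
Proof.
under eq_fun do rewrite sign_decomposition.
apply: bounded_measurable_sum => b; apply: bounded_measurableM.
  exact: bounded_measurable_cst.
exact: bounded_measurable_indic.
Qed.

Lemma mean_signs (phi : 'cV[R]_d -> R) :
  mean P (fun w => phi (signv (eps w))) =
  (2 ^+ d)^-1 * \sum_b phi (sign_vector b).
Proof.
under eq_fun do rewrite sign_decomposition.
rewrite mean_sum => [|b]; last first.
  by apply: bounded_measurableM; [exact: bounded_measurable_cst|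
    exact: bounded_measurable_indic].
rewrite mulr_sumr; apply: eq_bigr => b _; rewrite meanZ.
  by rewrite mean_event mulrC.
exact: bounded_measurable_indic.
Qed.

(** The [2^d] atoms at sign vectors are disjoint and have mass [2^-d] each, so their union has full
    measure. *)
Lemma signs_almost_surely : exists E : set Omega, [/\ measurable E,
  P (~` E) = 0%E & forall w, E w -> forall j, eps w j 0 = 1 \/ eps w j 0 = -1].
Proof.
pose D b := eps @^-1` [set sign_vector b].
have mD b : measurable (D b) by exact: measurable_sign_event.
have mE : measurable (\bigcup_(b in setT) D b).
  by apply: fin_bigcup_measurable => // b _; exact: finite_finset.
exists (\bigcup_(b in setT) D b); split => //; last first.
  move=> w [b _ wb] j; have -> : eps w j 0 = sign_vector b j 0 by rewrite -wb.
  by rewrite mxE; case: (b j); [left|right].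
rewrite probability_setC// -[P _]fineK ?fin_num_measure//.
suff -> : fine (P (\bigcup_(b in setT) D b)) = 1 by rewrite subee.
rewrite -mean_indic//.
have -> : \1_(\bigcup_(b in setT) D b) = (fun w => \sum_b \1_(D b) w) :> (Omega -> R).
  apply/funext => w; rewrite indicE; have [/set_mem[b _ wb]|nw] := boolP (_ \in _).
    rewrite (bigD1 b)//= indicE mem_set//= big1 ?addr0// => c cb.
    rewrite indicE memNset//= => wc; move/eqP: cb; apply; apply/ffunP => l.
    have : sign_vector c l 0 = sign_vector b l 0 by rewrite -wb -wc.
    rewrite !mxE; case: (c l) (b l) => -[]// /eqP.
      by rewrite gt_eqF// (lt_trans (ltrN10 _)).
    by rewrite lt_eqF// (lt_trans (ltrN10 _)).
  rewrite big1// => b _; rewrite indicE memNset// => wb.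
  by move/negP: nw; apply; apply/mem_set; exists b.
rewrite mean_sum => [|b]; last exact: bounded_measurable_indic.
rewrite (eq_bigr (fun=> (2 ^+ d)^-1)) => [|b _].
  rewrite sumr_const card_ffun card_bool card_ord -[LHS]mulr_natl natrX divff//.
rewrite mean_indic// /D eps_uniform// => j.
by rewrite mxE; case: (b j); [left|right].
Qed.

Lemma mean_rademacher_expR (a : 'I_d -> R) :
  mean P (fun w => expR (\sum_l a l * signv (eps w) l 0)) <=
  expR (\sum_l a l ^+ 2).
Proof.
rewrite (mean_signs (fun s => expR (\sum_l a l * s l 0))).
rewrite ler_pdivrMl ?exprn_gt0//; apply: le_trans (sum_rademacher_expR a).
by apply: ler_sum => b _; under eq_bigr do rewrite mxE.
Qed.

End signs.

(** * Dithering *)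

Section dither.
Context {R : realType}.

Definition clip (lam u : R) : R := Num.max (- lam) (Num.min u lam).

Lemma clip_id lam u : `|u| <= lam -> clip lam u = u.
Proof.
by rewrite ler_norml => /andP[ul lu]; rewrite /clip (min_idPl lu) (max_idPr ul).
Qed.

Lemma clip_sqr_le lam u : 0 <= lam -> clip lam u ^+ 2 <= u ^+ 2.
Proof.
move=> lam0; rewrite /clip /Num.max /Num.min.
by case: (ltP u lam) => h1; case: ltP => h2; nra.
Qed.

Lemma clip_error_sqr_le lam u : 0 <= lam -> (clip lam u - u) ^+ 2 <= u ^+ 2.
Proof.
move=> lam0; rewrite /clip /Num.max /Num.min.
by case: (ltP u lam) => h1; case: ltP => h2; nra.
Qed.

(** The half-line is the set where [u + y] gets the sign 1; it is closed because the sign of 0 is 1.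
    Its overlap with [[-lam, lam]] has length [lam + clip lam u], and this is where the clipping
    comes from. *)
Lemma integral_uniform_pdf_itv (lam u : R) : 0 < lam ->
  (\int[lebesgue_measure]_(y in `[(- u)%R, +oo[) (uniform_pdf (- lam) lam y)%:E)%E =
  ((lam + clip lam u) / (2 * lam))%:E.
Proof.
move=> lam0; set A := [set` `[- u, +oo[ ].
have -> : (\int[lebesgue_measure]_(y in A) (uniform_pdf (- lam) lam y)%:E =
  \int[lebesgue_measure]_(y in A `&` `[(- lam)%R, lam]) ((2 * lam)^-1)%:E)%E.
  rewrite [RHS]integral_mkcondr; apply: eq_integral => y _.
  rewrite /uniform_pdf patchE mem_setE in_itv/=.
  by case: ifP => // _; congr (_ ^-1)%:E; lra.
have -> : A `&` `[- lam, lam] = [set` `[Num.max (- u) (- lam), lam] ].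
  rewrite /A; apply/seteqP; split => y /=; rewrite !in_itv/= ?andbT ge_max.
    by move=> [-> /andP[-> ->]].
  by move=> /andP[/andP[-> ->] ->].
rewrite integral_cst//= lebesgue_measure_itv/= lte_fin.
rewrite /clip /Num.max /Num.min.
case: (ltP (- u) (- lam)) => h1; case: ltP => h2; case: (ltP u lam) => h3;
  case: ltP => h4; rewrite -?EFinB -?EFinM ?mule0; try (exfalso; lra);
  congr EFin; [| |have -> : u = lam by lra|]; by field; rewrite gt_eqF.
Qed.

Context {dO} {Omega : measurableType dO} (P : probability Omega R).
Context {d : nat} (tau : {RV P >-> 'cV[R]_d}) (lam : R).
Hypothesis lam_gt0 : 0 < lam.
Hypothesis tau_uniform : uniform_cube lam tau.

Let uniform_pdf_total :
  (\int[lebesgue_measure]_y (uniform_pdf (- lam) lam y)%:E = 1)%E.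
Proof.
have ab : - lam < lam by move: lam_gt0; lra.
exact: (integral_uniform_pdf1 ab (@subsetT _ _)).
Qed.

Lemma dither_tail (u : R) k :
  P [set w | 0 <= u + tau w k 0] = ((lam + clip lam u) / (2 * lam))%:E.
Proof.
(* The law is known only on boxes: the half-line in coordinate [k] is completed by whole lines,
   whose factors equal 1. *)
pose A (j : 'I_d) : set R := if j == k then [set` `[- u, +oo[] else setT.
have -> : [set w | 0 <= u + tau w k 0] = [set w | forall j, A j (tau w j 0)].
  apply/seteqP; split => w /=.
    move=> h j; rewrite /A; case: eqP => // ->.
    by rewrite /= in_itv/= andbT; lra.
  by move=> /(_ k); rewrite /A eqxx /= in_itv/= andbT; lra.
rewrite tau_uniform; last by move=> j; rewrite /A; case: ifP.
rewrite (bigD1 k)//= big1 => [|j /negPf jk]; last by rewrite /A jk uniform_pdf_total.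
by rewrite mule1 /A eqxx integral_uniform_pdf_itv.
Qed.

Lemma measurable_RV_coord (X : {RV P >-> 'cV[R]_d}) k :
  measurable_fun [set: Omega] (fun w => X w k 0).
Proof. exact: (measurableT_comp (measurable_coord k 0)). Qed.

Lemma bounded_measurable_signv (X : Omega -> 'cV[R]_d) k :
  measurable_fun [set: Omega] X ->
  bounded_measurable (fun w => signv (X w) k 0).
Proof.
move=> mX; split.
  under eq_fun do rewrite mxE.
  apply: measurable_fun_ifT => //.
  by apply: measurable_fun_ler => //; exact: (measurableT_comp (measurable_coord k 0)).
by exists 1 => w; rewrite mxE; case: ifP => _; rewrite ?normrN normr1.
Qed.

Lemma mean_dither (x : 'cV[R]_d) k :
  lam * mean P (fun w => signv (x + tau w) k 0) = clip lam (x k 0).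
Proof.
set A := [set w | 0 <= x k 0 + tau w k 0].
have mA : measurable A.
  have : measurable_fun [set: Omega] (fun w => 0 <= x k 0 + tau w k 0).
    apply: measurable_fun_ler => //; apply: measurable_funD => //.
    exact: measurable_RV_coord.
  by move=> /(_ measurableT [set true] I); rewrite setTI.
have -> : (fun w => signv (x + tau w) k 0) = (fun w => 2 * \1_A w - 1).
  apply/funext => w; rewrite !mxE indicE.
  have [h|h] := boolP (0 <= x k 0 + tau w k 0).
    by rewrite mem_set//=; lra.
  by rewrite memNset//=; [lra|exact/negP].
have bA := bounded_measurable_indic mA.
rewrite meanB; last exact: bounded_measurable_cst; last first.
  exact/bounded_measurableM/bA/bounded_measurable_cst.
rewrite mean_cst meanZ// mean_indic// dither_tail/=.
by field; rewrite gt_eqF.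
Qed.

End dither.

(** * Measurability of the transform *)

Section measurable_transform.
Context {R : realType} {dA} {A : measurableType dA} {d : nat}.
Implicit Types (h : A -> 'cV[R]_d).

Lemma measurable_coord_comp h j :
  measurable_fun [set: A] h -> measurable_fun [set: A] (fun a => h a j 0).
Proof. by move=> mh; exact: (measurableT_comp (measurable_coord j 0)). Qed.

Lemma measurable_cV h :
  (forall j, measurable_fun [set: A] (fun a => h a j 0)) ->
  measurable_fun [set: A] h.
Proof.
by move=> mh; apply: measurable_mx => i j; rewrite (ord1 j); exact: mh.
Qed.

Lemma measurable_cVD h1 h2 : measurable_fun [set: A] h1 ->
  measurable_fun [set: A] h2 -> measurable_fun [set: A] (fun a => h1 a + h2 a).
Proof.
move=> m1 m2; apply: measurable_cV => j; under eq_fun do rewrite mxE.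
by apply: measurable_funD; exact: measurable_coord_comp.
Qed.

Lemma measurable_cVZ (c : R) h : measurable_fun [set: A] h ->
  measurable_fun [set: A] (fun a => c *: h a).
Proof.
move=> mh; apply: measurable_cV => j; under eq_fun do rewrite mxE.
by apply: measurable_funM => //; exact: measurable_coord_comp.
Qed.

Lemma measurable_cV_sum I (s : seq I) (h : I -> A -> 'cV[R]_d) :
  (forall i, measurable_fun [set: A] (h i)) ->
  measurable_fun [set: A] (fun a => \sum_(i <- s) h i a).
Proof.
move=> mh; apply: measurable_cV => j; under eq_fun do rewrite summxE.
by apply: measurable_sum => i; exact: measurable_coord_comp.
Qed.

Lemma measurable_mulmxl (M : 'M[R]_d) h : measurable_fun [set: A] h ->
  measurable_fun [set: A] (fun a => M *m h a).
Proof.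
move=> mh; apply: measurable_cV => j; under eq_fun do rewrite mxE.
apply: measurable_sum => i; apply: measurable_funM => //.
exact: measurable_coord_comp.
Qed.

Lemma measurable_signv h : measurable_fun [set: A] h ->
  measurable_fun [set: A] (fun a => signv (h a)).
Proof.
move=> mh; apply: measurable_cV => j; under eq_fun do rewrite mxE.
apply: measurable_fun_ifT => //; apply: measurable_fun_ler => //.
exact: measurable_coord_comp.
Qed.

Lemma measurable_sign_diag e h : measurable_fun [set: A] e ->
  measurable_fun [set: A] h ->
  measurable_fun [set: A] (fun a => sign_diag (e a) *m h a).
Proof.
move=> me mh; apply: measurable_cV => j.
under eq_fun do rewrite /sign_diag mul_diag_mx mxE mxE.
apply: measurable_funM; last exact: measurable_coord_comp.
exact/measurable_coord_comp/measurable_signv.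
Qed.

Lemma measurable_dot h1 h2 : measurable_fun [set: A] h1 ->
  measurable_fun [set: A] h2 -> measurable_fun [set: A] (fun a => dot (h1 a) (h2 a)).
Proof.
move=> m1 m2; apply: measurable_sum => j.
by apply: measurable_funM; exact: measurable_coord_comp.
Qed.

Lemma measurable_norm2 h : measurable_fun [set: A] h ->
  measurable_fun [set: A] (fun a => norm2 (h a)).
Proof.
move=> mh; apply: (@measurableT_comp _ _ _ _ _ _ (@Num.sqrt R)).
  by apply: continuous_measurable_fun; exact: sqrt_continuous.
apply: measurable_sum => j; apply: measurable_funX; exact: measurable_coord_comp.
Qed.

Lemma measurable_rotate (H : 'M[R]_d) e h : measurable_fun [set: A] e ->
  measurable_fun [set: A] h -> measurable_fun [set: A] (fun a => rotate H (e a) (h a)).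
Proof. by move=> me mh; apply: measurable_mulmxl; exact: measurable_sign_diag. Qed.

Lemma measurable_rotate_back (H : 'M[R]_d) e h : measurable_fun [set: A] e ->
  measurable_fun [set: A] h ->
  measurable_fun [set: A] (fun a => rotate_back H (e a) (h a)).
Proof. by move=> me mh; apply: measurable_sign_diag => //; exact: measurable_mulmxl. Qed.

Lemma measurable_quantizer lam K (tau : 'I_K -> A -> 'cV[R]_d) h :
  (forall k, measurable_fun [set: A] (tau k)) -> measurable_fun [set: A] h ->
  measurable_fun [set: A] (fun a => quantizer lam (fun k => tau k a) (h a)).
Proof.
move=> mt mh; apply: measurable_cVZ; apply: measurable_cV_sum => k.
exact/measurable_signv/measurable_cVD.
Qed.

Lemma measurable_sign_transform (H : 'M[R]_d) lam K e
    (tau : 'I_K -> A -> 'cV[R]_d) h : measurable_fun [set: A] e ->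
  (forall k, measurable_fun [set: A] (tau k)) -> measurable_fun [set: A] h ->
  measurable_fun [set: A]
    (fun a => sign_transform H lam (e a) (fun k => tau k a) (h a)).
Proof.
move=> me mt mh; apply: measurable_rotate_back => //; apply: measurable_quantizer => //.
exact: measurable_rotate.
Qed.

End measurable_transform.

(** * Mean and second moment of the quantizer at a fixed point *)

Definition clip_vector {R : realType} {d} lam (x : 'cV[R]_d) : 'cV[R]_d :=
  \col_j clip lam (x j 0).

Section quantizer_moments.
Context {R : realType} {dO} {Omega : measurableType dO} (P : probability Omega R).
Context (I : choiceType) (F : I -> set (set Omega)).
Hypothesis sF : forall i, sigma_algebra setT (F i).
Hypothesis mF : forall i, F i `<=` measurable.
Hypothesis indF : mutually_independent P F.
Context {d K : nat} (tau : 'I_K -> {RV P >-> 'cV[R]_d}) (it : 'I_K -> I) (lam : R).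
Hypothesis lam_gt0 : 0 < lam.
Hypothesis K_gt0 : (0 < K)%N.
Hypothesis tau_uniform : forall k, uniform_cube lam (tau k).
Hypothesis it_inj : injective it.
Hypothesis tauF : forall k A, measurable A -> F (it k) (tau k @^-1` A).

Let mtau k : measurable_fun [set: Omega] (tau k).
Proof. by []. Qed.

Let K_neq0 : K%:R != 0 :> R. Proof. by rewrite pnatr_eq0 -lt0n. Qed.

Let bsign x i k : bounded_measurable (fun w => signv (x + tau i w) k 0).
Proof. by apply: bounded_measurable_signv; exact: measurable_cVD. Qed.

Let mean_sign x i k :
  mean P (fun w => signv (x + tau i w) k 0) = clip_vector lam x k 0 / lam.
Proof.
by rewrite mxE -(mean_dither lam_gt0 (tau_uniform i)) mulrC mulKf// gt_eqF.
Qed.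

Lemma mean_quantizer x c :
  mean P (fun w => dot (quantizer lam (fun k => tau k w) x) c) =
  dot (clip_vector lam x) c.
Proof.
under eq_fun do rewrite dot_quantizer.
have bs i k : bounded_measurable (fun w => signv (x + tau i w) k 0 * c k 0).
  by apply: bounded_measurableM => //; exact: bounded_measurable_cst.
rewrite meanZ; last by do 2 apply: bounded_measurable_sum => ?.
rewrite mean_sum => [|i]; last exact: bounded_measurable_sum.
under eq_bigr => i _.
  rewrite mean_sum//; under eq_bigr => k _.
    under eq_fun do rewrite mulrC; rewrite meanZ// mean_sign; over.
  over.
rewrite sumr_const card_ord -[X in _ * X]mulr_natl mulrA divfK//.
rewrite mulr_sumr; apply: eq_bigr => k _; rewrite mulrCA.
by rewrite mulrC mulrCA mulfV ?mulr1// gt_eqF.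
Qed.

Let mean_sign_pair x i i' k : i != i' ->
  mean P (fun w => signv (x + tau i w) k 0 * signv (x + tau i' w) k 0) =
  (clip_vector lam x k 0 / lam) ^+ 2.
Proof.
move=> ii'; rewrite (mean_independentM sF mF indF (J1 := [set it i]) (J2 := [set it i'])).
- by rewrite !mean_sign expr2.
- apply/seteqP; split => // j [/= -> /it_inj /eqP]; exact/negP.
- apply: bounded_measurable_signv; apply: measurable_cVD => //.
  exact: (@measurable_union_sigma1 _ _ _ F _ (it i)) (tauF i).
- apply: bounded_measurable_signv; apply: measurable_cVD => //.
  exact: (@measurable_union_sigma1 _ _ _ F _ (it i')) (tauF i').
Qed.

(** In each coordinate the square is a sum over pairs of dithers. The [K] diagonal pairs contribute
    1 each, whence the additional term; a pair of distinct dithers contributes the squared mean by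
    independence. The [K - 1] partners of a dither are counted as [K], which is harmless since a
    square is nonnegative. *)
Lemma mean_quantizer_sqr x :
  mean P (fun w => dot (quantizer lam (fun k => tau k w) x)
                       (quantizer lam (fun k => tau k w) x)) <=
  dot (clip_vector lam x) (clip_vector lam x) + d%:R * lam ^+ 2 / K%:R.
Proof.
have bs i i' k : bounded_measurable
    (fun w => signv (x + tau i w) k 0 * signv (x + tau i' w) k 0).
  exact: bounded_measurableM.
have E w : dot (quantizer lam (fun k => tau k w) x) (quantizer lam (fun k => tau k w) x) =
    (lam / K%:R) ^+ 2 * \sum_k \sum_i \sum_i'
      signv (x + tau i w) k 0 * signv (x + tau i' w) k 0.
  rewrite mulr_sumr; apply: eq_bigr => k _; rewrite !mxE !summxE.
  rewrite mulrACA -expr2 mulr_suml; congr (_ * _); apply: eq_bigr => i _.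
  by rewrite mulr_sumr.
under eq_fun do rewrite E.
rewrite meanZ; last by do 3 apply: bounded_measurable_sum => ?.
rewrite mean_sum => [|k]; last by do 2 apply: bounded_measurable_sum => ?.
have Kgt0 : (0 : R) < K%:R by rewrite ltr0n.
have le k : mean P (fun w => \sum_i \sum_i'
      signv (x + tau i w) k 0 * signv (x + tau i' w) k 0) <=
    K%:R + K%:R ^+ 2 * (clip_vector lam x k 0 / lam) ^+ 2.
  rewrite mean_sum => [|i]; last exact: bounded_measurable_sum.
  have le i : mean P (fun w => \sum_i'
      signv (x + tau i w) k 0 * signv (x + tau i' w) k 0) <=
      1 + K%:R * (clip_vector lam x k 0 / lam) ^+ 2.
    rewrite mean_sum// (bigD1 i)//= lerD//.
      under eq_fun => w.
        have -> : signv (x + tau i w) k 0 * signv (x + tau i w) k 0 = 1.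
          by rewrite mxE; case: ifP => _; rewrite ?mulr1// mulrNN mulr1.
        over.
      by rewrite mean_cst.
    rewrite (eq_bigr (fun=> (clip_vector lam x k 0 / lam) ^+ 2)); last first.
      by move=> i' ii'; rewrite mean_sign_pair// eq_sym.
    rewrite sumr_const -[leLHS]mulr_natl ler_wpM2r ?sqr_ge0// ler_nat.
    by rewrite (leq_trans (max_card _))// card_ord.
  apply: le_trans (ler_sum _ (fun i _ => le i)) _.
  by rewrite sumr_const card_ord -[leLHS]mulr_natl mulrDr mulr1 mulrA expr2.
apply: le_trans (_ : (lam / K%:R) ^+ 2 * \sum_(k < d)
   (K%:R + K%:R ^+ 2 * (clip_vector lam x k 0 / lam) ^+ 2) <= _).
  by rewrite ler_wpM2l ?sqr_ge0// ler_sum.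
rewrite big_split/= mulrDr addrC lerD//.
  rewrite mulr_sumr ler_sum// => k _; rewrite -expr2 le_eqVlt; apply/orP; left.
  by apply/eqP; field; rewrite K_neq0 gt_eqF.
rewrite sumr_const card_ord -[X in _ * X]mulr_natl le_eqVlt; apply/orP; left.
by apply/eqP; field.
Qed.

End quantizer_moments.

(** * Bias and second moment of the transform *)

Section transform_moments.
Context {R : realType} {dO} {Omega : measurableType dO} (P : probability Omega R).
Context (I : choiceType) (F : I -> set (set Omega)).
Hypothesis sF : forall i, sigma_algebra setT (F i).
Hypothesis mF : forall i, F i `<=` measurable.
Hypothesis indF : mutually_independent P F.
Context {d K : nat} (tau : 'I_K -> {RV P >-> 'cV[R]_d}) (it : 'I_K -> I).
Context (eps : {RV P >-> 'cV[R]_d}) (ie : I) (H : 'M[R]_d) (lam : R).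
Hypothesis lam_gt0 : 0 < lam.
Hypothesis K_gt0 : (0 < K)%N.
Hypothesis tau_uniform : forall k, uniform_cube lam (tau k).
Hypothesis it_inj : injective it.
Hypothesis tauF : forall k A, measurable A -> F (it k) (tau k @^-1` A).
Hypothesis eps_uniform : uniform_signs eps.
Hypothesis epsF : forall A, measurable A -> F ie (eps @^-1` A).
Hypothesis ie_it : forall k, it k <> ie.
Hypothesis HHT : H *m H^T = 1%:M.
Hypothesis H_flat : forall k l, `|H k l| = 1 / Num.sqrt d%:R.

Let JE : set I := [set ie].
Let JT : set I := range it.
Let disj : JE `&` JT = set0.
Proof. by apply/seteqP; split => // i [/= -> [k _ /ie_it]]. Qed.

Let TE := g_sigma_algebraType (union_sigma F JE).
Let TT := g_sigma_algebraType (union_sigma F JT).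

Let meps : measurable_fun [set: TE] (eps : TE -> 'cV[R]_d).
Proof. exact: (@measurable_union_sigma1 _ _ _ F _ ie). Qed.

Let mtau k : measurable_fun [set: TT] (tau k : TT -> 'cV[R]_d).
Proof. by apply: (@measurable_union_sigma1 _ _ _ F _ (it k)); [exists k|exact: tauF]. Qed.

(** The signs are read at [w] and the dither at [w'], so that the dither can be averaged for a
    frozen basis; the transform is the diagonal [w' = w]. *)
Let rotated_quantizer (w w' : Omega) x :=
  rotate_back H (eps w) (quantizer lam (fun k => tau k w') (rotate H (eps w) x)).

Let norm2_rotated_quantizer w w' x : norm2 (rotated_quantizer w w' x) <= lam * Num.sqrt d%:R.
Proof. by rewrite norm2_rotate_back// norm2_quantizer// ltW. Qed.

Let measurable_rotated_quantizer x :
  measurable_fun [set: TE * TT] (fun p => rotated_quantizer p.1 p.2 x).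
Proof.
have me : measurable_fun [set: TE * TT] (fun p => eps p.1).
  exact: (measurableT_comp meps (@measurable_fst _ _ TE TT)).
apply: measurable_rotate_back => //.
apply: (measurable_quantizer _ (tau := fun k (p : TE * TT) => tau k p.2)) => [k|].
  exact: (measurableT_comp (mtau k) (@measurable_snd _ _ TE TT)).
exact: measurable_rotate.
Qed.

Let sign_function (phi : 'cV[R]_d -> 'cV[R]_d -> R) x y :
  bounded_measurable (fun w => phi (rotate H (eps w) x) (rotate H (eps w) y)).
Proof.
exact: (bounded_measurable_signs eps
  (fun s => phi (H *m (diag_mx s^T *m x)) (H *m (diag_mx s^T *m y)))).
Qed.

(** For frozen signs the rotation back is moved to [c] by adjunction, and averaging the dither
    leaves the clipped vector. *)
Lemma mean_transform x c :
  mean P (fun w => dot (sign_transform H lam (eps w) (fun k => tau k w) x) c) =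
  mean P (fun w => dot (clip_vector lam (rotate H (eps w) x)) (rotate H (eps w) c)).
Proof.
have bphi : bounded_measurable (fun p : TE * TT => dot (rotated_quantizer p.1 p.2 x) c).
  split; first exact: measurable_dot.
  exists (lam * Num.sqrt d%:R * norm2 c) => p; rewrite (le_trans (normr_dot_le _ _))//.
  by rewrite ler_wpM2r ?norm2_ge0.
have [_ ->] := freezing sF mF indF (phi := fun w w' => dot (rotated_quantizer w w' x) c)
  disj bphi.
congr mean; apply/funext => w; under eq_fun do rewrite dot_rotate_back//.
by rewrite mean_quantizer.
Qed.

Lemma mean_transform_sqr x :
  mean P (fun w => dot (sign_transform H lam (eps w) (fun k => tau k w) x)
                       (sign_transform H lam (eps w) (fun k => tau k w) x)) <=
  dot x x + d%:R * lam ^+ 2 / K%:R.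
Proof.
have bphi : bounded_measurable (fun p : TE * TT =>
    dot (rotated_quantizer p.1 p.2 x) (rotated_quantizer p.1 p.2 x)).
  split; first exact: measurable_dot.
  exists ((lam * Num.sqrt d%:R) ^+ 2) => p; rewrite -norm2_sqr ger0_norm ?sqr_ge0//.
  by rewrite lerXn2r ?nnegrE ?norm2_ge0// mulr_ge0 ?sqrtr_ge0 ?ltW.
have [bw ->] := freezing sF mF indF
  (phi := fun w w' => dot (rotated_quantizer w w' x) (rotated_quantizer w w' x))
  disj bphi.
rewrite -[leRHS](mean_cst P); apply: ler_mean => //.
  exact: bounded_measurable_cst.
move=> w; under eq_fun do rewrite -norm2_sqr norm2_rotate_back// norm2_sqr.
apply: le_trans (mean_quantizer_sqr sF mF indF lam_gt0 K_gt0 tau_uniform it_inj tauF _) _.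
rewrite lerD2r -[in leRHS](@norm2_sqr _ _ x) -(norm2_rotate HHT (eps w)) norm2_sqr.
apply: ler_sum => k _; rewrite mxE -!expr2; apply: clip_sqr_le; exact: ltW.
Qed.

(** A smooth majorant of the indicator that some coordinate is clipped. It performs the Chernoff
    bound and the union bound at once, before any mean is taken. *)
Let clipping_error th (u : 'cV[R]_d) : R :=
  \sum_k (expR (th * (u k 0 - lam)) + expR (th * (- u k 0 - lam))).

(** Without clipping the left side vanishes. If some coordinate exceeds [lam] in absolute value, the
    majorant is at least 1, and the clipped part of [u] is never longer than [u] itself. *)
Let clipping_error_le th u c : 0 <= th ->
  `|dot (clip_vector lam u - u) c| <= norm2 u * norm2 c * clipping_error th u.
Proof.
move=> th0; have e0 : 0 <= clipping_error th u.
  by apply: sumr_ge0 => k _; rewrite addr_ge0 ?expR_ge0.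
have [/forallP h|] := boolP [forall k, `|u k 0| <= lam].
  have -> : clip_vector lam u = u by apply/colP => k; rewrite mxE clip_id.
  by rewrite subrr dot0l normr0 !mulr_ge0 ?norm2_ge0.
rewrite negb_forall => /existsP[k]; rewrite -ltNge => uk.
rewrite (le_trans (normr_dot_le _ _))//.
have le1 : norm2 (clip_vector lam u - u) <= norm2 u.
  apply: ler_wsqrtr; apply: ler_sum => j _; rewrite !mxE.
  by apply: clip_error_sqr_le; exact: ltW.
have le2 : 1 <= clipping_error th u.
  rewrite /clipping_error (bigD1 k)//= ler_wpDr//.
    by apply: sumr_ge0 => j _; rewrite addr_ge0 ?expR_ge0.
  have := expR_ge1Dx (th * (u k 0 - lam)); have := expR_ge1Dx (th * (- u k 0 - lam)).
  have := expR_ge0 (th * (u k 0 - lam)); have := expR_ge0 (th * (- u k 0 - lam)).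
  by move: uk; case: (ger0P (u k 0)) => uk0 uk; nra.
rewrite -[leLHS]mulr1 ler_pM ?mulr_ge0 ?norm2_ge0// ler_wpM2r ?norm2_ge0//.
Qed.

(** Both norms are invariant under the rotation, hence deterministic, and leave the mean; what
    remains are exponential moments of single coordinates. The parameter [th] stays free here and is
    optimized once the dither scale is known. *)
Lemma transform_bias x c B th : 0 <= th -> norm2 x <= B ->
  `|mean P (fun w => dot (sign_transform H lam (eps w) (fun k => tau k w) x) c)
    - dot x c| <=
  norm2 x * norm2 c * (2 * d%:R * expR (th ^+ 2 * B ^+ 2 / d%:R - th * lam)).
Proof.
move=> th0 xB; rewrite mean_transform.
have E w : dot x c = dot (rotate H (eps w) x) (rotate H (eps w) c).
  by rewrite -dot_rotate_back// rotate_backK.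
have bc := sign_function (fun u v => dot (clip_vector lam u) v) x c.
have bu := sign_function (fun u v => dot u v) x c.
have be := sign_function (fun u v => clipping_error th u) x c.
rewrite -[X in _ - X](mean_cst P) (_ : (fun=> dot x c) =
  (fun w => dot (rotate H (eps w) x) (rotate H (eps w) c))); last first.
  by apply/funext => w; exact: E.
rewrite -meanB//; apply: le_trans (_ : mean P (fun w =>
    norm2 x * norm2 c * clipping_error th (rotate H (eps w) x)) <= _); last first.
  rewrite meanZ// ler_wpM2l ?mulr_ge0 ?norm2_ge0//.
  rewrite mean_sum => [|k]; last first.
    exact: (sign_function (fun u v => expR (th * (u k 0 - lam)) + expR (th * (- u k 0 - lam))) x c).
  (* The factor [s] is 1 or -1 and serves the upper and the lower tail together. *)
  have d1 s k : `|s| = 1 -> mean P (fun w => expR (th * (s * rotate H (eps w) x k 0 - lam))) <=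
      expR (th ^+ 2 * B ^+ 2 / d%:R - th * lam).
    move=> s1; under eq_fun do rewrite mulrBr expRD [expR _ * _]mulrC.
    rewrite meanZ; last first.
      exact: (sign_function (fun u v => expR (th * (s * u k 0))) x c).
    rewrite addrC expRD ler_wpM2l ?expR_ge0//.
    have -> : (fun w => expR (th * (s * rotate H (eps w) x k 0))) =
        (fun w => expR (\sum_l (th * s * H k l * x l 0) * signv (eps w) l 0)).
      apply/funext => w; congr expR; rewrite mxE !mulr_sumr; apply: eq_bigr => l _.
      by rewrite /sign_diag mul_diag_mx !mxE; ring.
    apply: le_trans (mean_rademacher_expR eps_uniform _) _; rewrite ler_expR.
    (* Flatness of the basis enters here: every [(H k l)^2] is [1 / d], so each coordinate sees only
       [norm2 x ^+ 2 / d]. *)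
    have -> : \sum_l (th * s * H k l * x l 0) ^+ 2 = th ^+ 2 * norm2 x ^+ 2 / d%:R.
      rewrite norm2_sqr mulr_sumr mulr_suml; apply: eq_bigr => l _.
      rewrite !exprMn -(real_normK (num_real s)) s1 expr1n mulr1.
      rewrite -(real_normK (num_real (H k l))) H_flat expr_div_n expr1n sqr_sqrtr//.
      by ring.
    rewrite ler_wpM2r ?invr_ge0// ler_wpM2l ?sqr_ge0//.
    by rewrite lerXn2r ?nnegrE ?norm2_ge0// (le_trans (norm2_ge0 x)).
  apply: le_trans (_ : \sum_(k < d) 2 * expR (th ^+ 2 * B ^+ 2 / d%:R - th * lam) <= _).
    apply: ler_sum => k _; rewrite meanD; last 2 first.
    - exact: (sign_function (fun u v => expR (th * (u k 0 - lam))) x c).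
    - exact: (sign_function (fun u v => expR (th * (- u k 0 - lam))) x c).
    have h1 := d1 1 k (normr1 _); have := d1 (-1) k; rewrite normrN normr1 => /(_ erefl).
    under eq_fun do rewrite mulN1r; move: h1; under eq_fun do rewrite mul1r.
    lra.
  by rewrite sumr_const card_ord -[leLHS]mulr_natl mulrCA mulrA.
apply: ler_norm_mean; [exact: bounded_measurableB|exact/bounded_measurableM/be/bounded_measurable_cst|].
apply: aeW => w; rewrite -dotBl -(norm2_rotate HHT (eps w) x).
by rewrite -(norm2_rotate HHT (eps w) c) clipping_error_le.
Qed.

End transform_moments.

(** * The oracle *)

Section constants.
Context {R : realType} (d : nat) (alpha B : R).
Hypothesis d_ge2 : (2 <= d)%N.
Hypothesis alpha_ge3 : 3 <= alpha.
Hypothesis B_gt0 : 0 < B.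

(** Instantiated twice: with [alpha] and [B] for the workers, and with [alpha_s] and
    [alpha * B * Num.sqrt (ln d%:R)] for the server, whose dither scale has the same form. *)
Let lam : R := alpha * B * Num.sqrt (ln d%:R / d%:R).

Let d_gt0 : (0 : R) < d%:R. Proof. by rewrite ltr0n (leq_trans _ d_ge2). Qed.

Lemma ln_nat_gt0 : (0 : R) < ln d%:R.
Proof. by rewrite ln_gt0// ltr1n. Qed.

Lemma dither_scale_gt0 : 0 < lam.
Proof.
by rewrite !mulr_gt0// ?sqrtr_gt0 ?divr_gt0 ?ln_nat_gt0//; move: alpha_ge3; lra.
Qed.

Lemma dither_scale_sqr : d%:R * lam ^+ 2 = alpha ^+ 2 * B ^+ 2 * ln d%:R.
Proof.
rewrite /lam !exprMn sqr_sqrtr ?divr_ge0 ?ltW ?ln_nat_gt0//.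
by field; rewrite gt_eqF.
Qed.

Lemma dither_scale_norm : lam * Num.sqrt d%:R = alpha * B * Num.sqrt (ln d%:R).
Proof.
rewrite /lam -mulrA -sqrtrM ?divr_ge0 ?ltW ?ln_nat_gt0//.
by rewrite divfK ?gt_eqF.
Qed.

(* The Chernoff exponent is optimal at [th = lam d / (2 B^2)]; the union bound
   over the [d] coordinates is absorbed since [alpha^2 >= 8]. *)
Lemma clipping_tail : exists th, 0 <= th /\
  2 * d%:R * expR (th ^+ 2 * B ^+ 2 / d%:R - th * lam) <=
  2 * expR (- (alpha ^+ 2 * ln d%:R / 8)).
Proof.
exists (lam * d%:R / (2 * B ^+ 2)); split.
  apply: divr_ge0; last by rewrite mulr_ge0// sqr_ge0.
  by apply: mulr_ge0 => //; exact/ltW/dither_scale_gt0.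
have -> : (lam * d%:R / (2 * B ^+ 2)) ^+ 2 * B ^+ 2 / d%:R -
    lam * d%:R / (2 * B ^+ 2) * lam = - (d%:R * lam ^+ 2 / (4 * B ^+ 2)).
  by field; rewrite !gt_eqF.
rewrite dither_scale_sqr -mulrA ler_wpM2l// -[X in X * _](@lnK _ d%:R) ?posrE//.
rewrite -expRD ler_expR.
have -> : alpha ^+ 2 * B ^+ 2 * ln d%:R / (4 * B ^+ 2) = alpha ^+ 2 * ln d%:R / 4.
  by field; rewrite gt_eqF.
have : 9 * ln d%:R <= alpha ^+ 2 * ln d%:R.
  by apply: ler_wpM2r; [exact/ltW/ln_nat_gt0|move: alpha_ge3 => ?; nra].
by have := ln_nat_gt0; lra.
Qed.

End constants.

(** * The truncated oracle and its mean *)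

Section oracle_copy.
Context {R : realType} {d : nat}.
Context {dS} {S : measurableType dS} (Q : probability S R).
Context {dX} {X : measurableType dX} (xi0 : {RV Q >-> X}).
Context {dO} {Omega : measurableType dO} (P : probability Omega R).
Context (xi : {RV P >-> X}).
Hypothesis xi_copy : copy_of xi0 xi.
Variables (g : X -> 'cV[R]_d -> 'cV[R]_d) (f : 'cV[R]_d -> R) (B : R).
Hypothesis g_oracle : stochastic_gradient_oracle xi0 g f.
Hypothesis B_ge0 : 0 <= B.
Variable y : 'cV[R]_d.
Hypothesis g_bounded : {ae Q, forall s, norm2 (g (xi0 s) y) <= B}.

(** The bound on the oracle holds only almost surely, at each point [y] with its own null set.
    Cutting off outside the ball gives a function bounded everywhere with the same mean; the scheme
    itself keeps using [g]. *)
Definition truncated_oracle (u : X) : 'cV[R]_d :=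
  if norm2 (g u y) <= B then g u y else 0.

Lemma measurable_oracle_section : measurable_fun [set: X] (fun u => g u y).
Proof.
have [mg _] := g_oracle.
exact: (measurableT_comp mg (@pair2_measurable _ _ X 'cV[R]_d y)).
Qed.

Lemma measurable_truncated_oracle : measurable_fun [set: X] truncated_oracle.
Proof.
apply: measurable_fun_ifT => //; last exact: measurable_oracle_section.
apply: measurable_fun_ler => //.
exact/measurable_norm2/measurable_oracle_section.
Qed.

Lemma norm2_truncated_oracle u : norm2 (truncated_oracle u) <= B.
Proof.
rewrite /truncated_oracle; case: ifP => // _.
by rewrite /norm2 big1 ?sqrtr0// => j _; rewrite mxE expr0n.
Qed.

Lemma bounded_measurable_truncated_oracle j :
  bounded_measurable (fun u => truncated_oracle u j 0).
Proof.
split; first exact: measurable_coord_comp measurable_truncated_oracle.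
by exists B => u; rewrite (le_trans (coord_le_norm2 _ _))// norm2_truncated_oracle.
Qed.

Lemma mean_copy (h : X -> R) : bounded_measurable h ->
  mean P (h \o xi) = mean Q (h \o xi0).
Proof.
move=> [mh [M hM]].
have b1 : bounded_measurable (h \o xi).
  by split; [exact: measurableT_comp|exists M => w; exact: hM].
have b0 : bounded_measurable (h \o xi0).
  by split; [exact: measurableT_comp|exists M => w; exact: hM].
apply: EFin_inj; rewrite -!expectation_mean// unlock.
transitivity (\int[distribution P xi]_u (h u)%:E)%E.
  rewrite integral_distribution//; first exact/measurable_EFinP.
  exact: bounded_measurable_integrable.
rewrite (eq_measure_integral (distribution Q xi0)) => [|A mA _]; last exact: xi_copy.
rewrite integral_distribution//; first exact/measurable_EFinP.
exact: bounded_measurable_integrable.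
Qed.

(** Equality of laws concerns measurable subsets of [X], so the exceptional event is written as the
    preimage of the measurable set [A] before it is carried from [Q] to [P]. *)
Lemma copy_bounded_ae : {ae P, forall w, norm2 (g (xi w) y) <= B}.
Proof.
pose A := [set u | ~~ (norm2 (g u y) <= B)].
have mA : measurable A.
  have -> : A = (fun u => norm2 (g u y) <= B) @^-1` [set false].
    by rewrite /A; apply/seteqP; split => u /=; case: (norm2 _ <= B).
  have : measurable_fun [set: X] (fun u => norm2 (g u y) <= B).
    apply: measurable_fun_ler => //.
    exact/measurable_norm2/measurable_oracle_section.
  move=> /(_ measurableT [set false] I); rewrite setTI.
  exact.
exists (xi @^-1` A); split => //.
- exact: measurable_funPTI.
- rewrite -[LHS]/(distribution P xi A) xi_copy//.
  have [M [mM M0 sub]] := g_bounded; apply/eqP; rewrite -measure_le0 -M0.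
  apply: (@le_measure _ _ _ Q (xi0 @^-1` A) M); rewrite ?inE//.
    exact: measurable_funPTI.
  by move=> s /negP h; apply: sub.
- by move=> w /negP.
Qed.

Lemma mean_truncated_oracle j :
  mean P (fun w => truncated_oracle (xi w) j 0) = gradient f y j 0.
Proof.
have bt := bounded_measurable_truncated_oracle j.
rewrite (mean_copy bt); apply: EFin_inj.
have bt0 : bounded_measurable ((fun u => truncated_oracle u j 0) \o xi0).
  by case: bt => mt [M tM]; split; [exact: measurableT_comp|exists M => w; exact: tM].
rewrite -expectation_mean//; have [_ <-] := g_oracle; rewrite unlock.
apply: ae_eq_integral => //.
- by apply/measurable_EFinP; case: bt0.
- apply/measurable_EFinP; apply: measurable_coord_comp.
  exact: (measurableT_comp measurable_oracle_section).
- by apply: filterS g_bounded => s gB _; rewrite /= /truncated_oracle gB.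
Qed.

Lemma bounded_measurable_truncated_dot c :
  bounded_measurable (fun w => dot (truncated_oracle (xi w)) c).
Proof.
split; last first.
  exists (B * norm2 c) => w; rewrite (le_trans (normr_dot_le _ _))//.
  by rewrite ler_wpM2r ?norm2_ge0// norm2_truncated_oracle.
apply: measurable_dot => //; exact: (measurableT_comp measurable_truncated_oracle).
Qed.

Lemma mean_truncated_dot c :
  mean P (fun w => dot (truncated_oracle (xi w)) c) = dot (gradient f y) c.
Proof.
have bt j : bounded_measurable (fun w => truncated_oracle (xi w) j 0).
  case: (bounded_measurable_truncated_oracle j) => mt [M tM].
  split; last by exists M => w; exact: tM.
  exact: (measurableT_comp mt).
rewrite mean_sum => [|j].
  apply: eq_bigr => j _; under eq_fun do rewrite mulrC.
  by rewrite meanZ// mean_truncated_oracle mulrC.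
by apply: bounded_measurableM => //; exact: bounded_measurable_cst.
Qed.

(** The gradient is a mean of vectors of norm at most [B]. This Lipschitz bound makes [f] bounded
    along the iterates. *)
Lemma norm2_gradient_le : norm2 (gradient f y) <= B.
Proof.
apply: norm2_le => // c; rewrite -mean_truncated_dot.
apply: le_trans (ler_norm _) _; apply: normr_mean_le => [|w].
  exact: bounded_measurable_truncated_dot.
rewrite (le_trans (normr_dot_le _ _))//.
by rewrite ler_wpM2r ?norm2_ge0// norm2_truncated_oracle.
Qed.

End oracle_copy.

(** * One step of the scheme *)

Section sources.
Context {T N K : nat}.
Implicit Type s : source T N K.

Definition source_time s : 'I_T.+1 :=
  match s with
  | Oracle t _ | Signs t _ | Dither t _ _ | ServerSigns t | ServerDither t _ => t
  end.

Definition source_worker s : option 'I_N :=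
  match s with
  | Oracle _ n | Signs _ n | Dither _ n _ => Some n
  | ServerSigns _ | ServerDither _ _ => None
  end.

(** These index sets play the role of a filtration: the iterate at time [t] depends on
    [sources_before t], the step from it uses fresh sources from [sources_at]. Within a step, server
    and workers, and any two workers, occupy disjoint sets. *)
Definition sources_before (t : nat) := [set s | (source_time s < t)%N].
Definition sources_at t := [set s | source_time s = t].
Definition workers_at t := [set s | source_time s = t /\ source_worker s <> None].
Definition server_at t := [set s | source_time s = t /\ source_worker s = None].
Definition worker_at t n := [set s | source_time s = t /\ source_worker s = Some n].

End sources.

Section step.
Context {R : realType} {d N K T : nat} (H : 'M[R]_d).
Context {dS} {S : measurableType dS} (Q : probability S R).
Context {dX} {X : measurableType dX} (xi0 : {RV Q >-> X}).
Variables (g : X -> 'cV[R]_d -> 'cV[R]_d) (f : 'cV[R]_d -> R).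
Variables (B alpha alpha_s : R).
Context {dO} {Omega : measurableType dO} (P : probability Omega R).
Variables
  (xi : 'I_T.+1 -> 'I_N -> {RV P >-> X})
  (eps : 'I_T.+1 -> 'I_N -> {RV P >-> 'cV[R]_d})
  (tau : 'I_T.+1 -> 'I_N -> 'I_1 -> {RV P >-> 'cV[R]_d})
  (eps_s : 'I_T.+1 -> {RV P >-> 'cV[R]_d})
  (tau_s : 'I_T.+1 -> 'I_K -> {RV P >-> 'cV[R]_d}).
Let lam := alpha * B * Num.sqrt (ln d%:R / d%:R).
Let lam_s := alpha_s * lam * Num.sqrt (ln d%:R).
Hypothesis d_ge2 : (2 <= d)%N.
Hypothesis HHT : H *m H^T = 1%:M.
Hypothesis H_flat : forall k l, `|H k l| = 1 / Num.sqrt d%:R.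
Hypothesis N_gt0 : (0 < N)%N.
Hypothesis K_gt0 : (0 < K)%N.
Hypothesis g_oracle : stochastic_gradient_oracle xi0 g f.
Hypothesis B_gt0 : 0 < B.
Hypothesis g_bounded : forall y, {ae Q, forall s, norm2 (g (xi0 s) y) <= B}.
Hypothesis alpha_ge3 : 3 <= alpha.
Hypothesis alpha_s_ge3 : 3 <= alpha_s.
Hypothesis xi_copy : forall t n, copy_of xi0 (xi t n).
Hypothesis eps_uniform : forall t n, uniform_signs (eps t n).
Hypothesis tau_uniform : forall t n k, uniform_cube lam (tau t n k).
Hypothesis eps_s_uniform : forall t, uniform_signs (eps_s t).
Hypothesis tau_s_uniform : forall t k, uniform_cube lam_s (tau_s t k).
Hypothesis indF : all_independent xi eps tau eps_s tau_s.

Let F := source_sigma xi eps tau eps_s tau_s.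

Let L : R := ln d%:R.
Let B_s := alpha * B * Num.sqrt L.

Let B_s_gt0 : 0 < B_s.
Proof.
by rewrite !mulr_gt0// ?sqrtr_gt0 ?ln_nat_gt0//; move: alpha_ge3; lra.
Qed.

Let lam_sE : lam_s = alpha_s * B_s * Num.sqrt (ln d%:R / d%:R).
Proof. by rewrite /lam_s /lam /B_s; ring. Qed.

Let lam_gt0 : 0 < lam. Proof. exact: dither_scale_gt0. Qed.

Let lam_s_gt0 : 0 < lam_s. Proof. by rewrite lam_sE; exact: dither_scale_gt0. Qed.

Lemma source_sigma_algebra i : sigma_algebra setT (F i).
Proof.
by case: i => *; apply: sigma_algebra_preimage; exact: sigma_algebra_measurable.
Qed.

Lemma source_sigma_measurable i : F i `<=` measurable.
Proof.
by case: i => *; move=> _ [A mA <-]; rewrite setTI; exact: measurable_funPTI.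
Qed.

Let sF := source_sigma_algebra.
Let mF := source_sigma_measurable.

Let preimageF {d'} {T' : measurableType d'} (Y : {RV P >-> T'}) A :
  measurable A -> g_sigma_algebra_preimage Y (Y @^-1` A).
Proof. by move=> mA; exists A => //; rewrite setTI. Qed.

Let TJ J := g_sigma_algebraType (union_sigma F J).

Section measurable_source.
Context {dA} {A : measurableType dA} (J : set (source T N K)) (om : A -> Omega).
Hypothesis mom : measurable_fun [set: A] (om : A -> TJ J).

(** The map [om] is arbitrary so that one statement covers the identity of [Omega] as well as both
    projections of a product of two coarser spaces, as freezing requires. *)
Let source_comp {d'} {T' : measurableType d'} (Y : {RV P >-> T'}) i :
  J i -> F i = g_sigma_algebra_preimage Y ->
  measurable_fun [set: A] (fun a => Y (om a)).
Proof.
move=> Ji FY; have mY : measurable_fun [set: TJ J] (Y : TJ J -> T').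
  apply: (@measurable_union_sigma1 _ _ _ F _ i) => // C mC.
  by rewrite FY; exact: preimageF.
exact: (measurableT_comp mY mom).
Qed.

Lemma measurable_oracle_source t n : J (Oracle _ t n) ->
  measurable_fun [set: A] (fun a => xi t n (om a)).
Proof. by move=> Ji; exact: source_comp Ji erefl. Qed.

Lemma measurable_signs_source t n : J (Signs _ t n) ->
  measurable_fun [set: A] (fun a => eps t n (om a)).
Proof. by move=> Ji; exact: source_comp Ji erefl. Qed.

Lemma measurable_dither_source t n k : J (Dither _ t n k) ->
  measurable_fun [set: A] (fun a => tau t n k (om a)).
Proof. by move=> Ji; exact: source_comp Ji erefl. Qed.

Lemma measurable_server_signs_source t : J (ServerSigns _ _ t) ->
  measurable_fun [set: A] (fun a => eps_s t (om a)).
Proof. by move=> Ji; exact: source_comp Ji erefl. Qed.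

Lemma measurable_server_dither_source t k : J (ServerDither _ t k) ->
  measurable_fun [set: A] (fun a => tau_s t k (om a)).
Proof. by move=> Ji; exact: source_comp Ji erefl. Qed.

End measurable_source.

(** The coding randomness is read at [w'] and the oracle at [w], which allows the coding to be
    averaged for a frozen oracle sample; the scheme is the diagonal. *)
Definition coded_gradient t n (w' w : Omega) y : 'cV[R]_d :=
  sign_transform H lam (eps t n w') (fun k => tau t n k w') (g (xi t n w) y).

Definition aggregate t w y : 'cV[R]_d :=
  N%:R^-1 *: \sum_(n < N) coded_gradient t n w w y.

Definition coded_aggregate t (w' w : Omega) y : 'cV[R]_d :=
  sign_transform H lam_s (eps_s t w') (fun k => tau_s t k w') (aggregate t w y).

Lemma measurable_coded_gradient t n {dA} {A : measurableType dA} J' J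
    (om' om : A -> Omega) (h : A -> 'cV[R]_d) :
  measurable_fun [set: A] (om' : A -> TJ J') ->
  measurable_fun [set: A] (om : A -> TJ J) -> measurable_fun [set: A] h ->
  worker_at t n `\ Oracle K t n `<=` J' -> J (Oracle _ t n) ->
  measurable_fun [set: A] (fun a => coded_gradient t n (om' a) (om a) (h a)).
Proof.
move=> mom' mom mh sJ' Jo.
apply: (measurable_sign_transform _ _ (tau := fun k a => tau t n k (om' a))).
- by apply: (measurable_signs_source mom'); apply: sJ'; split.
- by move=> k; apply: (measurable_dither_source mom'); apply: sJ'; split.
have [mg _] := g_oracle.
have mp := measurable_fun_pair (measurable_oracle_source mom Jo) mh.
exact: (measurableT_comp mg mp).
Qed.

Lemma measurable_aggregate t {dA} {A : measurableType dA} J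
    (om : A -> Omega) (h : A -> 'cV[R]_d) :
  measurable_fun [set: A] (om : A -> TJ J) -> measurable_fun [set: A] h ->
  workers_at t `<=` J ->
  measurable_fun [set: A] (fun a => aggregate t (om a) (h a)).
Proof.
move=> mom mh sJ; apply: measurable_cVZ; apply: measurable_cV_sum => n.
apply: (measurable_coded_gradient mom mom mh); last by apply: sJ.
by move=> s [[st sn] _]; apply: sJ; split => //; rewrite sn.
Qed.

Lemma measurable_coded_aggregate t {dA} {A : measurableType dA} J' J
    (om' om : A -> Omega) (h : A -> 'cV[R]_d) :
  measurable_fun [set: A] (om' : A -> TJ J') ->
  measurable_fun [set: A] (om : A -> TJ J) -> measurable_fun [set: A] h ->
  server_at t `<=` J' -> workers_at t `<=` J ->
  measurable_fun [set: A] (fun a => coded_aggregate t (om' a) (om a) (h a)).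
Proof.
move=> mom' mom mh sJ' sJ.
apply: (measurable_sign_transform _ _ (tau := fun k a => tau_s t k (om' a))).
- by apply: (measurable_server_signs_source mom'); apply: sJ'.
- by move=> k; apply: (measurable_server_dither_source mom'); apply: sJ'.
exact: measurable_aggregate mom mh sJ.
Qed.

Lemma norm2_coded_gradient t n w' w y : norm2 (coded_gradient t n w' w y) = B_s.
Proof.
rewrite norm2_rotate_back// norm2_quantizer1 ?ltW//.
exact: dither_scale_norm.
Qed.

Lemma norm2_aggregate_le t w y : norm2 (aggregate t w y) <= B_s.
Proof.
have N0 : (0 : R) < N%:R by rewrite ltr0n.
apply: norm2_le => [|c]; first exact: ltW.
rewrite dotZl dot_suml ler_pdivrMl//.
apply: le_trans (_ : \sum_(n < N) B_s * norm2 c <= _).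
  apply: ler_sum => n _; rewrite (le_trans (dot_le_norm2 _ _))//.
  by rewrite norm2_coded_gradient.
by rewrite sumr_const card_ord mulr_natl.
Qed.

Lemma norm2_coded_aggregate_le t w' w y :
  norm2 (coded_aggregate t w' w y) <= alpha_s * B_s * Num.sqrt L.
Proof.
rewrite norm2_rotate_back// (le_trans (norm2_quantizer _ _ (ltW lam_s_gt0) K_gt0))//.
by rewrite lam_sE dither_scale_norm.
Qed.

Let tail := expR (- (alpha ^+ 2 * L / 8)).
Let tail_s := expR (- (alpha_s ^+ 2 * L / 8)).

Section frozen_point.
Variables (t : 'I_T.+1) (y : 'cV[R]_d).

Let mid J : measurable_fun [set: TJ J] (idfun : TJ J -> TJ J).
Proof. exact: measurable_id. Qed.

(** For a frozen sample the coding is unbiased up to the clipping tail, provided the sample has norm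
    at most [B]. This is so almost surely, and there the sample equals its truncation, whose mean is
    the gradient. *)
Lemma coded_gradient_bias n c :
  `|mean P (fun w => dot (coded_gradient t n w w y) c) - dot (gradient f y) c| <=
  2 * B * tail * norm2 c.
Proof.
pose J1 : set (source T N K) := [set Oracle K t n].
pose J2 := worker_at t n `\ Oracle K t n.
have J12 : J1 `&` J2 = set0 by apply/seteqP; split => // s [/= -> [_]] /(_ erefl).
pose phi w w' := dot (coded_gradient t n w' w y) c.
have bphi : bounded_measurable (fun p : TJ J1 * TJ J2 => phi p.1 p.2).
  split; last first.
    exists (B_s * norm2 c) => p; rewrite (le_trans (normr_dot_le _ _))//.
    by rewrite norm2_coded_gradient.
  apply: measurable_dot => //.
  have m1 := @measurable_fst _ _ (TJ J1) (TJ J2).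
  have m2 := @measurable_snd _ _ (TJ J1) (TJ J2).
  exact: (measurable_coded_gradient m2 m1 (h := fun=> y)).
have [bm ->] := freezing sF mF indF J12 bphi.
rewrite -(mean_truncated_dot (xi_copy t n) g_oracle (ltW B_gt0) (g_bounded y)).
have bt := bounded_measurable_truncated_dot (xi t n) g_oracle (ltW B_gt0) y c.
rewrite -meanB// -[leRHS](mean_cst P); apply: ler_norm_mean.
- exact: bounded_measurableB.
- exact: bounded_measurable_cst.
apply: filterS (copy_bounded_ae (xi_copy t n) g_oracle (g_bounded y)) => w gB.
rewrite /truncated_oracle gB.
have [th [th0 thP]] := clipping_tail d_ge2 alpha_ge3 B_gt0.
have := @transform_bias _ _ _ P _ F sF mF indF d 1 (tau t n) (fun k => Dither K t n k)
  (eps t n) (Signs K t n) H lam lam_gt0 isT (tau_uniform t n).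
move=> /(_ (fun k A mA => preimageF (tau t n k) mA) (eps_uniform t n)).
move=> /(_ (fun A mA => preimageF (eps t n) mA)).
have ie_it k : Dither K t n k <> Signs K t n by [].
move=> /(_ ie_it HHT H_flat (g (xi t n w) y) c B th th0 gB) h.
apply: (le_trans h).
rewrite (_ : 2 * B * tail * norm2 c = B * norm2 c * (2 * tail)); last by ring.
by rewrite ler_pM ?mulr_ge0 ?norm2_ge0 ?expR_ge0// ler_wpM2r ?norm2_ge0.
Qed.

Let z n w := coded_gradient t n w w y.

Let mz n J : worker_at t n `<=` J ->
  measurable_fun [set: TJ J] (z n : TJ J -> 'cV[R]_d).
Proof.
move=> sJ; apply: (measurable_coded_gradient (mid (J := J)) (mid (J := J)) (h := fun=> y)) => //.
- by move=> s [/sJ].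
- exact: sJ.
Qed.

Let bz n j J : worker_at t n `<=` J ->
  @bounded_measurable R _ (TJ J) (fun w => z n w j 0).
Proof.
move=> sJ; split; first by apply: measurable_coord_comp; exact: mz.
by exists B_s => w; rewrite (le_trans (coord_le_norm2 _ _))// norm2_coded_gradient.
Qed.

Let bzO n j : bounded_measurable (fun w => z n w j 0).
Proof.
have [mc [M hM]] := bz j (@subset_refl _ (worker_at t n)).
by split; [exact: (measurable_union_sigma mF mc)|exists M].
Qed.

Let bzc n c : bounded_measurable (fun w => dot (z n w) c).
Proof.
by apply: bounded_measurable_sum => j; apply: bounded_measurableM => //;
  exact: bounded_measurable_cst.
Qed.

Let mu n : 'cV[R]_d := \col_j mean P (fun w => z n w j 0).

Let muE n j : mu n j 0 = mean P (fun w => z n w j 0).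
Proof. exact: mxE. Qed.

Let dot_mu n c : dot (mu n) c = mean P (fun w => dot (z n w) c).
Proof.
rewrite mean_sum => [|j].
  apply: eq_bigr => j _; rewrite mxE mulrC -meanZ//.
  by congr mean; apply/funext => w; rewrite mulrC.
by apply: bounded_measurableM => //; exact: bounded_measurable_cst.
Qed.

Let dot_mu_le n : dot (mu n) (mu n) <=
  2 * norm2 (gradient f y) ^+ 2 + 8 * B ^+ 2 * tail.
Proof.
have b0 : 0 <= 2 * B * tail by rewrite !mulr_ge0 ?expR_ge0// ltW.
have e : norm2 (mu n - gradient f y) <= 2 * B * tail.
  apply: norm2_le => // c; rewrite dotBl dot_mu.
  exact: le_trans (ler_norm _) (coded_gradient_bias n c).
have -> : mu n = gradient f y + (mu n - gradient f y) by rewrite addrC subrK.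
apply: le_trans (dot_sqrD_le _ _) _; rewrite -!norm2_sqr lerD2l.
(* This makes the squared bias linear in [tail]; the constant 8 is twice the square of the 2 in the
   bias. *)
have t1 : tail <= 1.
  rewrite -expR0 ler_expR oppr_le0 divr_ge0// mulr_ge0 ?sqr_ge0//.
  exact/ltW/ln_nat_gt0.
have t0 : 0 <= tail by exact: expR_ge0.
have : norm2 (mu n - gradient f y) ^+ 2 <= (2 * B * tail) ^+ 2.
  by rewrite lerXn2r ?nnegrE ?norm2_ge0.
have : (2 * B * tail) ^+ 2 <= 4 * B ^+ 2 * tail.
  rewrite (_ : (2 * B * tail) ^+ 2 = 4 * B ^+ 2 * tail * tail); last by ring.
  by rewrite ler_piMr// mulr_ge0// mulr_ge0// sqr_ge0.
lra.
Qed.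

Let mean_dot_z n m : n != m ->
  mean P (fun w => dot (z n w) (z m w)) = dot (mu n) (mu m).
Proof.
move=> nm; rewrite mean_sum => [|j]; last exact: bounded_measurableM.
apply: eq_bigr => j _.
transitivity (mean P (fun w => z n w j 0) * mean P (fun w => z m w j 0)); last first.
  by congr (_ * _); exact/esym/muE.
apply: (mean_independentM sF mF indF (J1 := worker_at t n) (J2 := worker_at t m)).
- apply/seteqP; split => // s [[_ sn] [_]]; rewrite sn => -[/eqP].
  by rewrite (negPf nm).
- exact: bz.
- exact: bz.
Qed.

(** The square is a double sum over workers. Each diagonal term equals [B_s ^+ 2] exactly and there
    are [N] of them, which after division by [N^2] gives the [1 / N]. By independence the other
    terms are scalar products of mean vectors, close to the gradient, and are bounded by [M] through
    [dot_le2]. *)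
Lemma mean_aggregate_sqr :
  mean P (fun w => dot (aggregate t w y) (aggregate t w y)) <=
  2 * norm2 (gradient f y) ^+ 2 + 8 * B ^+ 2 * tail + B_s ^+ 2 / N%:R.
Proof.
set M := 2 * _ + _.
have M0 : 0 <= M.
  apply: addr_ge0; first by apply: mulr_ge0; rewrite ?sqr_ge0.
  by apply: mulr_ge0; [apply: mulr_ge0; rewrite ?sqr_ge0|exact: expR_ge0].
have mu_le n : dot (mu n) (mu n) <= M by exact: dot_mu_le.
clearbody M; have N0 : (0 : R) < N%:R by rewrite ltr0n.
have bzz n m : bounded_measurable (fun w => dot (z n w) (z m w)).
  by apply: bounded_measurable_sum => j; exact: bounded_measurableM.
have E w : dot (aggregate t w y) (aggregate t w y) =
    N%:R^-1 ^+ 2 * \sum_n \sum_m dot (z n w) (z m w).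
  rewrite dotZl dotZr mulrA -expr2 dot_suml; congr (_ * _); apply: eq_bigr => n _.
  by rewrite dotC dot_suml; apply: eq_bigr => m _; rewrite dotC.
under eq_fun do rewrite E.
rewrite meanZ; last by do 2 apply: bounded_measurable_sum => ?.
rewrite mean_sum => [|n]; last exact: bounded_measurable_sum.
have le n : mean P (fun w => \sum_m dot (z n w) (z m w)) <= B_s ^+ 2 + N%:R * M.
  rewrite mean_sum// (bigD1 n)//= lerD//.
    under eq_fun do rewrite -norm2_sqr norm2_coded_gradient.
    by rewrite mean_cst.
  apply: le_trans (_ : \sum_(m < N | m != n) M <= _).
    apply: ler_sum => m mn; rewrite mean_dot_z 1?eq_sym//.
    apply: le_trans (dot_le2 _ _) _.
    rewrite ler_pdivrMr// mulr_natr mulr2n; exact: lerD (mu_le n) (mu_le m).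
  rewrite sumr_const -[leLHS]mulr_natl ler_wpM2r// ler_nat.
  by rewrite (leq_trans (max_card _))// card_ord.
apply: le_trans (_ : N%:R^-1 ^+ 2 * \sum_(n < N) (B_s ^+ 2 + N%:R * M) <= _).
  by rewrite ler_wpM2l ?sqr_ge0// ler_sum.
rewrite sumr_const card_ord -[X in _ * X]mulr_natl le_eqVlt; apply/orP; left.
by apply/eqP; field; rewrite gt_eqF.
Qed.

Lemma aggregate_bias c :
  `|mean P (fun w => dot (aggregate t w y) c) - dot (gradient f y) c| <=
  2 * B * tail * norm2 c.
Proof.
have N0 : (0 : R) < N%:R by rewrite ltr0n.
under eq_fun do rewrite dotZl dot_suml.
rewrite meanZ; last by apply: bounded_measurable_sum => n; exact: bzc.
rewrite mean_sum => [|n]; last exact: bzc.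
have -> : dot (gradient f y) c = N%:R^-1 * \sum_(n < N) dot (gradient f y) c.
  by rewrite sumr_const card_ord -[X in _ * X]mulr_natl mulKf// gt_eqF.
rewrite -mulrBr -sumrB normrM ger0_norm ?invr_ge0 ?(ltW N0)// ler_pdivrMl//.
apply: le_trans (ler_norm_sum _ _ _) _.
apply: le_trans (ler_sum _ (fun n _ => coded_gradient_bias n c)) _.
by rewrite sumr_const card_ord -[leLHS]mulr_natl.
Qed.

Let J1 : set (source T N K) := workers_at t.
Let J2 : set (source T N K) := server_at t.

Let J12 : J1 `&` J2 = set0.
Proof. by apply/seteqP; split => // s [[_ h] [_]]. Qed.

Let measurable_frozen_aggregate : measurable_fun [set: TJ J1 * TJ J2]
  (fun p => coded_aggregate t p.2 p.1 y).
Proof.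
have m1 := @measurable_fst _ _ (TJ J1) (TJ J2).
have m2 := @measurable_snd _ _ (TJ J1) (TJ J2).
exact: (measurable_coded_aggregate m2 m1 (h := fun=> y)).
Qed.

Let bagg c : bounded_measurable (fun w => dot (aggregate t w y) c).
Proof.
split; last first.
  exists (B_s * norm2 c) => w; rewrite (le_trans (normr_dot_le _ _))//.
  by rewrite ler_wpM2r ?norm2_ge0// norm2_aggregate_le.
apply: (measurable_union_sigma mF (J := J1)); apply: measurable_dot => //.
exact: (measurable_aggregate (mid (J := J1)) (h := fun=> y)).
Qed.

Let bagg2 : bounded_measurable (fun w => dot (aggregate t w y) (aggregate t w y)).
Proof.
split; last first.
  exists (B_s ^+ 2) => w; rewrite -norm2_sqr ger0_norm ?sqr_ge0//.
  by rewrite lerXn2r ?nnegrE ?norm2_ge0 ?(ltW B_s_gt0)// norm2_aggregate_le.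
apply: (measurable_union_sigma mF (J := J1)); apply: measurable_dot => //;
exact: (measurable_aggregate (mid (J := J1)) (h := fun=> y)).
Qed.

Let server_bias w c :
  `|mean P (fun w' => dot (coded_aggregate t w' w y) c) - dot (aggregate t w y) c|
  <= 2 * B_s * tail_s * norm2 c.
Proof.
have [th [th0 thP]] := clipping_tail d_ge2 alpha_s_ge3 B_s_gt0.
have := @transform_bias _ _ _ P _ F sF mF indF d K (tau_s t) (fun k => ServerDither N t k)
  (eps_s t) (ServerSigns N K t) H lam_s lam_s_gt0 K_gt0 (tau_s_uniform t).
move=> /(_ (fun k A mA => preimageF (tau_s t k) mA) (eps_s_uniform t)).
move=> /(_ (fun A mA => preimageF (eps_s t) mA)).
have ie_it k : ServerDither N t k <> ServerSigns N K t by [].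
move=> /(_ ie_it HHT H_flat _ c B_s th th0 (norm2_aggregate_le t w y)) h.
apply: (le_trans h).
rewrite (_ : 2 * B_s * tail_s * norm2 c = B_s * norm2 c * (2 * tail_s)); last by ring.
rewrite ler_pM ?mulr_ge0 ?norm2_ge0 ?expR_ge0//.
  by rewrite ler_wpM2r ?norm2_ge0// norm2_aggregate_le.
by rewrite {1}lam_sE.
Qed.

Lemma coded_aggregate_bias c :
  `|mean P (fun w => dot (coded_aggregate t w w y) c) - dot (gradient f y) c| <=
  (2 * B * tail + 2 * B_s * tail_s) * norm2 c.
Proof.
have bphi : bounded_measurable
    (fun p : TJ J1 * TJ J2 => dot (coded_aggregate t p.2 p.1 y) c).
  split; last first.
    exists (alpha_s * B_s * Num.sqrt L * norm2 c) => p.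
    rewrite (le_trans (normr_dot_le _ _))//.
    by rewrite ler_wpM2r ?norm2_ge0// norm2_coded_aggregate_le.
  by apply: measurable_dot.
have [bm ->] := freezing (phi := fun w w' => dot (coded_aggregate t w' w y) c)
  sF mF indF J12 bphi.
rewrite mulrDl [leRHS]addrC.
rewrite -(subrKA (mean P (fun w => dot (aggregate t w y) c))).
apply: le_trans (ler_normD _ _) _; apply: lerD; last exact: aggregate_bias.
rewrite -meanB//; apply: normr_mean_le; first exact: bounded_measurableB.
by move=> w; exact: server_bias.
Qed.

Lemma mean_coded_aggregate_sqr :
  mean P (fun w => dot (coded_aggregate t w w y) (coded_aggregate t w w y)) <=
  2 * norm2 (gradient f y) ^+ 2 + 8 * B ^+ 2 * tail + alpha ^+ 2 * B ^+ 2 * L / N%:R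
  + alpha_s ^+ 2 * alpha ^+ 2 * B ^+ 2 * L ^+ 2 / K%:R.
Proof.
have L0 : 0 <= L by exact/ltW/ln_nat_gt0.
have B_sE : B_s ^+ 2 = alpha ^+ 2 * B ^+ 2 * L by rewrite !exprMn sqr_sqrtr.
have bphi : bounded_measurable (fun p : TJ J1 * TJ J2 =>
    dot (coded_aggregate t p.2 p.1 y) (coded_aggregate t p.2 p.1 y)).
  split; last first.
    exists ((alpha_s * B_s * Num.sqrt L) ^+ 2) => p.
    rewrite -norm2_sqr ger0_norm ?sqr_ge0// lerXn2r ?nnegrE ?norm2_ge0//.
      exact: le_trans (norm2_ge0 _) (norm2_coded_aggregate_le t p.2 p.1 y).
    exact: norm2_coded_aggregate_le.
  by apply: measurable_dot.
have [bm ->] := freezing (phi := fun w w' => dot (coded_aggregate t w' w y)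
  (coded_aggregate t w' w y)) sF mF indF J12 bphi.
have it_inj : injective (fun k : 'I_K => ServerDither N t k) by move=> k k' [].
have ie_it k : ServerDither N t k <> ServerSigns N K t by [].
apply: le_trans (_ : mean P (fun w => dot (aggregate t w y) (aggregate t w y)
    + d%:R * lam_s ^+ 2 / K%:R) <= _).
  apply: ler_mean => //.
    by apply: bounded_measurableD => //; exact: bounded_measurable_cst.
  move=> w; exact: (@mean_transform_sqr _ _ _ P _ F sF mF indF d K (tau_s t)
    (fun k => ServerDither N t k) (eps_s t) (ServerSigns N K t) H lam_s lam_s_gt0
    K_gt0 (tau_s_uniform t) it_inj (fun k A mA => preimageF (tau_s t k) mA)
    (fun A mA => preimageF (eps_s t) mA) ie_it HHT).
rewrite meanD//; last exact: bounded_measurable_cst.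
rewrite mean_cst lerD//.
  by apply: le_trans mean_aggregate_sqr _; rewrite B_sE.
(* One factor [L] comes from the dither scale of the server, the other from the bound [B_s] on its
   input, hence [L ^+ 2]. *)
rewrite lam_sE dither_scale_sqr// B_sE le_eqVlt; apply/orP; left.
by apply/eqP; rewrite -/L; ring.
Qed.

End frozen_point.
End step.

(** * Descent along a biased direction *)

Section gradient.
Context {R : realType} {d : nat}.
Implicit Types (f : 'cV[R]_d -> R) (x y v : 'cV[R]_d).

(** The limit is taken along [1 / (n + 1)], since a sequence of measurable difference quotients
    makes the gradient measurable; the same sequence yields the tangent inequality for convex
    functions. *)
Lemma cvg_difference_quotient f x v : differentiable f x ->
  n.+1%:R * (f (n.+1%:R^-1 *: v + x) - f x) @[n --> \oo] --> 'D_v f x.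
Proof.
move=> df; have cq := @diff_derivable _ _ _ f x v df.
have u0 : (harmonic : R^nat) @ \oo --> (0 : R)^'.
  move=> A A0; have : \forall n \near \oo, (harmonic n : R) != 0 -> A (harmonic n).
    exact: (@cvg_harmonic R _ A0).
  by apply: filterS => n; apply; rewrite invr_eq0 pnatr_eq0.
have := cvg_comp _ _ u0 cq.
rewrite (_ : _ \o _ = fun n : nat => n.+1%:R * (f (n.+1%:R^-1 *: v + x) - f x))//.
by apply/funext => n /=; rewrite /harmonic invrK.
Qed.

Lemma derive_dot f x v : differentiable f x -> 'D_v f x = dot (gradient f x) v.
Proof.
move=> df; rewrite deriveE//.
have -> : v = \sum_(j < d) v j 0 *: delta_mx j 0.
  rewrite [LHS]matrix_sum_delta; apply: eq_bigr => j _; by rewrite big_ord1.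
rewrite linear_sum/=; apply: eq_bigr => j _; rewrite linearZ/= mxE deriveE//.
rewrite mulrC; congr (_ * _); rewrite summxE (bigD1 j)//= !mxE !eqxx mulr1.
rewrite big1 ?addr0// => i ij; rewrite !mxE eqxx andbT eq_sym (negPf ij) mulr0//.
Qed.

Lemma convex_gradient_le f x y : convex_function [set: 'cV[R]_d] f ->
  differentiable f x -> f x + dot (gradient f x) (y - x) <= f y.
Proof.
move=> cf df; rewrite -lerBrDl -derive_dot//.
apply: (cvgr_to_le (cvg_difference_quotient (v := y - x) df)).
apply: nearW => n; have N0 : (0 : R) < n.+1%:R by [].
rewrite -ler_pdivlMl//.
have n01 : (0 <= (n.+1%:R^-1 : R) <= 1).
  by rewrite invr_ge0 ltW//= invf_le1// ler1n.
have /andP[p0 p1] := n01.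
have := cf (Itv01 p0 p1) y x (mem_set I) (mem_set I).
move: {n01} (n.+1%:R^-1) p0 p1 => p p0 p1; rewrite convRE /conv /= /unstable.onem => h.
have -> : p *: (y - x) + x = p *: y + (1 - p) *: x.
  by rewrite scalerBr scalerBl scale1r addrA addrAC.
by move: h; lra.
Qed.

Lemma measurable_gradient f : (forall y, differentiable f y) ->
  measurable_fun [set: 'cV[R]_d] (gradient f).
Proof.
move=> df; have mf : measurable_fun [set: 'cV[R]_d] f.
  by apply: continuous_mx_measurable => y; exact: differentiable_continuous.
apply: measurable_cV => j; under eq_fun do rewrite mxE.
apply: measurable_fun_cvg (fun y _ => cvg_difference_quotient (v := delta_mx j 0) (df y)).
move=> n; apply: measurable_funM => //; apply: measurable_funB => //.
apply: (measurableT_comp mf); apply: measurable_cVD => //.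
Qed.

Lemma norm2D_le x y : norm2 (x + y) <= norm2 x + norm2 y.
Proof.
apply: norm2_le => [|c]; first by rewrite addr_ge0 ?norm2_ge0.
by rewrite dotDl mulrDl lerD ?dot_le_norm2.
Qed.

End gradient.

(** * Telescoping and conditioning on the past *)

Section biased_descent.
Context {R : realType} {d : nat} {dO} {Omega : measurableType dO}.
Context (P : probability Omega R).
Context (I : choiceType) (F : I -> set (set Omega)).
Hypothesis sF : forall i, sigma_algebra setT (F i).
Hypothesis mF : forall i, F i `<=` measurable.
Hypothesis indF : mutually_independent P F.
Variables (past now : nat -> set I) (T : nat).
Variables (V : nat -> Omega -> 'cV[R]_d -> 'cV[R]_d) (f : 'cV[R]_d -> R).
Variables (x0 : 'cV[R]_d) (delta D B beta M : R).

Let TJ J := g_sigma_algebraType (union_sigma F J).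

Hypothesis past_now : forall t, (t <= T)%N -> past t `&` now t = set0.
Hypothesis past_future : forall t, (t <= T)%N -> past t `<=` past t.+1.
Hypothesis now_future : forall t, (t <= T)%N -> now t `<=` past t.+1.
Hypothesis delta_gt0 : 0 < delta.
Hypothesis B_ge0 : 0 <= B.
Hypothesis D_ge0 : 0 <= D.
Hypothesis measurable_V : forall t J dA (A : measurableType dA) (om : A -> Omega)
  (h : A -> 'cV[R]_d), now t `<=` J ->
  measurable_fun [set: A] (om : A -> TJ J) -> measurable_fun [set: A] h ->
  measurable_fun [set: A] (fun a => V t (om a) (h a)).
Hypothesis V_bounded : forall t w y, norm2 (V t w y) <= D.
Hypothesis V_bias : forall t y c,
  `|mean P (fun w => dot (V t w y) c) - dot (gradient f y) c| <= beta * norm2 c.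
Hypothesis V_sqr : forall t y, mean P (fun w => dot (V t w y) (V t w y)) <=
  2 * norm2 (gradient f y) ^+ 2 + M.
Hypothesis f_convex : convex_function [set: 'cV[R]_d] f.
Hypothesis f_diff : forall y, differentiable f y.
Hypothesis f_lipschitz : forall y, norm2 (gradient f y) <= B.

Fixpoint iterate t w : 'cV[R]_d :=
  if t is t'.+1 then iterate t' w - delta *: V t' w (iterate t' w) else x0.

Let mid J : measurable_fun [set: TJ J] (idfun : TJ J -> TJ J).
Proof. exact: measurable_id. Qed.

Lemma measurable_iterate t : (t <= T.+1)%N ->
  measurable_fun [set: TJ (past t)] (iterate t : TJ (past t) -> 'cV[R]_d).
Proof.
elim: t => [_|t ih tT]; first exact: measurable_cst.
have mt : measurable_fun [set: TJ (past t.+1)] (iterate t : TJ (past t.+1) -> 'cV[R]_d).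
  exact: (@sub_union_sigma _ _ _ F _ _ _ _ _ (past_future tT) (ih (ltnW tT))).
have -> : iterate t.+1 = fun w => iterate t w + (- delta) *: V t w (iterate t w).
  by apply/funext => w /=; rewrite scaleNr.
apply: measurable_cVD => //; apply: measurable_cVZ.
exact: (measurable_V (now_future tT) (mid (J := past t.+1)) mt).
Qed.

(** Each step has length at most [delta * D], for every outcome. This deterministic radius makes all
    integrands below bounded. *)
Lemma norm2_iterate_le t w c :
  norm2 (iterate t w - c) <= norm2 (x0 - c) + t%:R * (delta * D).
Proof.
elim: t => [|t ih] /=; first by rewrite mul0r addr0.
rewrite addrAC; apply: le_trans (norm2D_le _ _) _; rewrite norm2N -natr1 mulrDl mul1r addrA.
rewrite lerD//; have -> : norm2 (delta *: V t w (iterate t w)) =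
    delta * norm2 (V t w (iterate t w)).
  apply: (@pexpIrn _ 2); rewrite ?nnegrE ?mulr_ge0 ?norm2_ge0// ?(ltW delta_gt0)//.
  by rewrite norm2_sqr dotZl dotZr -norm2_sqr exprMn mulrA -expr2.
by rewrite ler_wpM2l// ltW.
Qed.

Variable xs : 'cV[R]_d.

Let radius t := norm2 (x0 - xs) + t%:R * (delta * D).

(** The tangent at [xs] bounds [f y] from below and the tangent at [y] bounds it from above. *)
Let f_growth y : `|f y| <= `|f xs| + B * norm2 (y - xs).
Proof.
have h1 := convex_gradient_le (x := xs) y f_convex (f_diff xs).
have h2 := convex_gradient_le (x := y) xs f_convex (f_diff y).
have g1 : `|dot (gradient f xs) (y - xs)| <= B * norm2 (y - xs).
  by rewrite (le_trans (normr_dot_le _ _))// ler_wpM2r ?norm2_ge0.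
have g2 : `|dot (gradient f y) (xs - y)| <= B * norm2 (y - xs).
  rewrite (le_trans (normr_dot_le _ _))// -[norm2 (xs - y)]norm2N opprB.
  by rewrite ler_wpM2r ?norm2_ge0.
move: g1 g2; rewrite !ler_norml => /andP[g1 g1'] /andP[g2 g2'].
have := ler_norm (f xs); have := ler_norm (- f xs); rewrite normrN => a1 a2.
by apply/andP; split; lra.
Qed.

Let mf : measurable_fun [set: 'cV[R]_d] f.
Proof. by apply: continuous_mx_measurable => y; exact: differentiable_continuous. Qed.

Lemma bounded_measurable_f t : (t <= T.+1)%N ->
  bounded_measurable (fun w => f (iterate t w)).
Proof.
move=> tT; split.
  apply: (measurable_union_sigma mF (J := past t)).
  exact: (measurableT_comp mf (measurable_iterate tT)).
exists (`|f xs| + B * radius t) => w; apply: le_trans (f_growth _) _.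
by rewrite lerD2l ler_wpM2l// norm2_iterate_le.
Qed.

Lemma bounded_measurable_distance t : (t <= T.+1)%N ->
  bounded_measurable (fun w => norm2 (iterate t w - xs)).
Proof.
move=> tT; split; last first.
  by exists (radius t) => w; rewrite ger0_norm ?norm2_ge0// norm2_iterate_le.
apply: (measurable_union_sigma mF (J := past t)); apply: measurable_norm2.
by apply: measurable_cVD => //; exact: measurable_iterate.
Qed.

Lemma bounded_measurable_gradient_sqr t : (t <= T.+1)%N ->
  bounded_measurable (fun w => norm2 (gradient f (iterate t w)) ^+ 2).
Proof.
move=> tT; split; last first.
  exists (B ^+ 2) => w; rewrite ger0_norm ?sqr_ge0//.
  by rewrite lerXn2r ?nnegrE ?norm2_ge0.
apply: (measurable_union_sigma mF (J := past t)).
apply: measurable_funX; apply: measurable_norm2.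
exact: (measurableT_comp (measurable_gradient f_diff) (measurable_iterate tT)).
Qed.

Lemma bounded_measurable_average :
  bounded_measurable (fun w => f (average_iterate T iterate w)).
Proof.
have mi t : (t <= T.+1)%N -> measurable_fun [set: Omega] (iterate t).
  by move=> tT; exact: (measurable_union_sigma mF (measurable_iterate tT)).
split.
  apply: (measurableT_comp mf); apply: measurable_cVZ; apply: measurable_cV_sum => t.
  exact/mi/ltnW.
exists (`|f xs| + B * radius T.+1) => w; apply: le_trans (f_growth _) _.
rewrite lerD2l ler_wpM2l//.
have r0 : 0 <= radius T.+1.
  by rewrite addr_ge0 ?norm2_ge0// !mulr_ge0// ltW.
apply: norm2_le => // c.
have T0 : (0 : R) < T.+1%:R by [].
have -> : average_iterate T iterate w - xs =
    T.+1%:R^-1 *: \sum_(t < T.+1) (iterate t w - xs).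
  rewrite sumrB scalerBr sumr_const card_ord -[xs *+ _]scaler_nat scalerA.
  by rewrite mulVf ?scale1r// gt_eqF.
rewrite dotZl dot_suml ler_pdivrMl//.
apply: le_trans (_ : \sum_(t < T.+1) radius T.+1 * norm2 c <= _).
  apply: ler_sum => t _; rewrite (le_trans (dot_le_norm2 _ _))//.
  rewrite ler_wpM2r ?norm2_ge0// (le_trans (norm2_iterate_le _ _ _))//.
  rewrite lerD2l ler_wpM2r ?mulr_ge0// ?(ltW delta_gt0)// ler_nat.
  exact: ltnW.
by rewrite sumr_const card_ord mulr_natl.
Qed.

Let step t w := V t w (iterate t w).

Let frozen_step t (tT : (t <= T)%N) : measurable_fun [set: TJ (past t) * TJ (now t)]
  (fun p => V t p.2 (iterate t p.1)).
Proof.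
have m1 := @measurable_fst _ _ (TJ (past t)) (TJ (now t)).
have m2 := @measurable_snd _ _ (TJ (past t)) (TJ (now t)).
exact: (measurable_V (@subset_refl _ _) m2
  (measurableT_comp (measurable_iterate (leqW tT)) m1)).
Qed.

Let mstep t : (t <= T)%N -> measurable_fun [set: Omega] (step t).
Proof.
move=> tT; apply: (measurable_union_sigma mF (J := past t.+1)).
apply: (measurable_V (now_future tT) (mid (J := past t.+1))).
exact: (@sub_union_sigma _ _ _ F _ _ _ _ _ (past_future tT) (measurable_iterate (leqW tT))).
Qed.

Let bstep t : (t <= T)%N -> bounded_measurable (fun w => dot (step t w) (iterate t w - xs)).
Proof.
move=> tT; split.
  apply: measurable_dot; first exact: mstep.
  apply: measurable_cVD => //.
  exact: (measurable_union_sigma mF (measurable_iterate (leqW tT))).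
exists (D * radius t) => w; rewrite (le_trans (normr_dot_le _ _))//.
by rewrite ler_pM ?norm2_ge0//; [exact: V_bounded|exact: norm2_iterate_le].
Qed.

Let bstep2 t : (t <= T)%N -> bounded_measurable (fun w => dot (step t w) (step t w)).
Proof.
move=> tT; split; first by apply: measurable_dot; exact: mstep.
exists (D ^+ 2) => w; rewrite -norm2_sqr ger0_norm ?sqr_ge0//.
by rewrite lerXn2r ?nnegrE ?norm2_ge0//; exact: V_bounded.
Qed.

(** With the iterate frozen, the mean direction is the gradient up to [beta], and the tangent
    inequality turns the gradient term into a gap of function values. The error keeps the random
    distance to [xs], and this is how the averaged distance enters the final bound. *)
Let descent_inner t : (t <= T)%N ->
  mean P (fun w => f (iterate t w)) - f xs
    - beta * mean P (fun w => norm2 (iterate t w - xs)) <=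
  mean P (fun w => dot (step t w) (iterate t w - xs)).
Proof.
move=> tT.
have bphi : bounded_measurable (fun p : TJ (past t) * TJ (now t) =>
    dot (V t p.2 (iterate t p.1)) (iterate t p.1 - xs)).
  split; last first.
    exists (D * radius t) => p; rewrite (le_trans (normr_dot_le _ _))//.
    by rewrite ler_pM ?norm2_ge0//; exact: norm2_iterate_le.
  apply: measurable_dot; first exact: frozen_step.
  apply: measurable_cVD => //.
  exact: (measurableT_comp (measurable_iterate (leqW tT))
    (@measurable_fst _ _ (TJ (past t)) (TJ (now t)))).
have [bm ->] := freezing (phi := fun w w' => dot (V t w' (iterate t w)) (iterate t w - xs))
  sF mF indF (past_now tT) bphi.
have bf := bounded_measurable_f (leqW tT).
have bd := bounded_measurable_distance (leqW tT).
have bbd : bounded_measurable (fun w => beta * norm2 (iterate t w - xs)).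
  exact/bounded_measurableM/bd/bounded_measurable_cst.
have bfx : bounded_measurable (fun w => f (iterate t w) - f xs).
  exact/bounded_measurableB/bounded_measurable_cst.
rewrite -meanZ// -[X in _ - X - _](mean_cst P) -!meanB//; last exact: bounded_measurable_cst.
apply: ler_mean => // [|w]; first exact: bounded_measurableB.
have := V_bias t (iterate t w) (iterate t w - xs).
rewrite ler_norml => /andP[h _].
have := convex_gradient_le (x := iterate t w) xs f_convex (f_diff _).
rewrite -[xs - _]opprB dotC dotNl dotC; lra.
Qed.

Let descent_sqr t : (t <= T)%N -> mean P (fun w => dot (step t w) (step t w)) <=
  2 * mean P (fun w => norm2 (gradient f (iterate t w)) ^+ 2) + M.
Proof.
move=> tT.
have bphi : bounded_measurable (fun p : TJ (past t) * TJ (now t) =>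
    dot (V t p.2 (iterate t p.1)) (V t p.2 (iterate t p.1))).
  split; last first.
    exists (D ^+ 2) => p; rewrite -norm2_sqr ger0_norm ?sqr_ge0//.
    by rewrite lerXn2r ?nnegrE ?norm2_ge0//; exact: V_bounded.
  by apply: measurable_dot; exact: frozen_step.
have [bm ->] := freezing (phi := fun w w' => dot (V t w' (iterate t w)) (V t w' (iterate t w)))
  sF mF indF (past_now tT) bphi.
have bg := bounded_measurable_gradient_sqr (leqW tT).
have b2 : bounded_measurable (fun w => 2 * norm2 (gradient f (iterate t w)) ^+ 2).
  exact/bounded_measurableM/bg/bounded_measurable_cst.
have bM : bounded_measurable (fun _ : Omega => M) by exact: bounded_measurable_cst.
rewrite -meanZ// -[X in _ + X](mean_cst P) -meanD//.
by apply: ler_mean => //; exact: bounded_measurableD.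
Qed.

Let bdist2 t : (t <= T.+1)%N ->
  bounded_measurable (fun w => dot (iterate t w - xs) (iterate t w - xs)).
Proof.
move=> tT; under eq_fun do rewrite -norm2_sqr expr2.
by apply: bounded_measurableM; exact: bounded_measurable_distance.
Qed.

Let telescope t : (t <= T.+1)%N ->
  mean P (fun w => dot (iterate t w - xs) (iterate t w - xs)) =
  norm2 (xs - x0) ^+ 2 +
  \sum_(i < t) (delta ^+ 2 * mean P (fun w => dot (step i w) (step i w))
   - 2 * delta * mean P (fun w => dot (step i w) (iterate i w - xs))).
Proof.
elim: t => [_|t ih tT].
  by rewrite big_ord0 addr0 /= mean_cst -norm2_sqr -norm2N opprB.
rewrite big_ord_recr/= addrA -ih ?(ltnW tT)//.
have b1 := bdist2 (ltnW tT); have b2 := bstep2 tT; have b3 := bstep tT.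
have bc (c : R) g : bounded_measurable g -> bounded_measurable (fun w : Omega => c * g w).
  by move=> bg; apply/bounded_measurableM/bg/bounded_measurable_cst.
rewrite -!meanZ// -meanB; [|exact: bc|exact: bc].
rewrite -meanD//; last by apply: bounded_measurableB; exact: bc.
congr mean; apply/funext => w; rewrite -/(step t w).
rewrite addrAC; move: (iterate t w - xs) (step t w) => u v.
rewrite dotBl !dotBr !dotZl !dotZr (dotC u v); ring.
Qed.

Lemma biased_descent :
  mean P (fun w => f (average_iterate T iterate w)) - f xs <=
  1 / (2 * T.+1%:R * delta) * norm2 (xs - x0) ^+ 2
  + delta / T.+1%:R *
    \sum_(t < T.+1) mean P (fun w => norm2 (gradient f (iterate t w)) ^+ 2)
  + delta * M / 2
  + beta * mean P (fun w => T.+1%:R^-1 * \sum_(t < T.+1) norm2 (iterate t w - xs)).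
Proof.
have T0 : (0 : R) < T.+1%:R by [].
have tT (t : 'I_T.+1) : (t <= T)%N by rewrite -ltnS.
have tT1 (t : 'I_T.+1) : (t <= T.+1)%N by rewrite ltnW.
set a := fun t : 'I_T.+1 => mean P (fun w => f (iterate t w)).
set e := fun t : 'I_T.+1 => mean P (fun w => norm2 (iterate t w - xs)).
set G := fun t : 'I_T.+1 => mean P (fun w => norm2 (gradient f (iterate t w)) ^+ 2).
have bf (t : 'I_T.+1) := bounded_measurable_f (tT1 t).
have bd (t : 'I_T.+1) := bounded_measurable_distance (tT1 t).
have jensen : mean P (fun w => f (average_iterate T iterate w)) <= T.+1%:R^-1 * \sum_t a t.
  rewrite -mean_sum// -meanZ; last exact: bounded_measurable_sum.
  apply: ler_mean; first exact: bounded_measurable_average.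
    apply: bounded_measurableM; first exact: bounded_measurable_cst.
    exact: bounded_measurable_sum.
  move=> w; set m := average_iterate T iterate w.
  rewrite -ler_pdivrMl ?invr_gt0// invrK.
  (* Jensen's inequality through the tangent at the average [m]: the linear terms cancel in the
     sum. *)
  have -> : T.+1%:R * f m =
      \sum_(t < T.+1) (f m + dot (gradient f m) (iterate t w - m)).
    rewrite big_split/= sumr_const card_ord mulr_natl -[LHS]addr0; congr (_ + _).
    under eq_bigr do rewrite dotC.
    rewrite -dot_suml sumrB sumr_const card_ord -[m *+ _]scaler_nat.
    by rewrite /m /average_iterate scalerA mulfV ?gt_eqF// scale1r subrr dot0l.
  by apply: ler_sum => t _; exact: convex_gradient_le.
have eta : mean P (fun w => T.+1%:R^-1 * \sum_(t < T.+1) norm2 (iterate t w - xs)) =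
    T.+1%:R^-1 * \sum_t e t.
  by rewrite meanZ ?mean_sum//; exact: bounded_measurable_sum.
have tele : 2 * delta * \sum_t (a t - f xs - beta * e t) <=
    norm2 (xs - x0) ^+ 2 + delta ^+ 2 * \sum_t (2 * G t + M).
  have := telescope (leqnn T.+1).
  set A := fun t : 'I_T.+1 => mean P (fun w => dot (step t w) (iterate t w - xs)).
  set W := fun t : 'I_T.+1 => mean P (fun w => dot (step t w) (step t w)).
  rewrite sumrB -!mulr_sumr.
  (* The squared distance after all [T + 1] steps is the end of the telescope and is dropped by
     sign. *)
  have : 0 <= mean P (fun w => dot (iterate T.+1 w - xs) (iterate T.+1 w - xs)).
    rewrite -[leLHS](mean_cst P); apply: ler_mean; [exact: bounded_measurable_cst| |].
      exact: bdist2.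
    by move=> w; exact: dot_ge0.
  have hA : 2 * delta * \sum_t (a t - f xs - beta * e t) <= 2 * delta * \sum_t A t.
    by rewrite ler_pM2l ?mulr_gt0//; apply: ler_sum => t _; exact: descent_inner.
  have hW : delta ^+ 2 * \sum_t W t <= delta ^+ 2 * \sum_t (2 * G t + M).
    by rewrite ler_pM2l ?exprn_gt0//; apply: ler_sum => t _; exact: descent_sqr.
  by move=> h0 h1; move: hA hW; rewrite /A /W; lra.
rewrite eta; move: jensen tele.
rewrite !sumrB -mulr_sumr big_split/= -mulr_sumr !sumr_const card_ord.
rewrite -[f xs *+ _]mulr_natl -[M *+ _]mulr_natl.
move: (\sum_t a t) (\sum_t e t) (\sum_t G t) => sa se sG jensen tele.
rewrite lerBlDr; apply: (le_trans jensen); rewrite ler_pdivrMl//.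
rewrite -(ler_pM2l (_ : 0 < 2 * delta)); last by rewrite mulr_gt0.
have -> : 2 * delta * (T.+1%:R * (1 / (2 * T.+1%:R * delta) * norm2 (xs - x0) ^+ 2 +
    delta / T.+1%:R * sG + delta * M / 2 + beta * (T.+1%:R^-1 * se) + f xs)) =
    norm2 (xs - x0) ^+ 2 + delta ^+ 2 * (2 * sG + T.+1%:R * M)
    + 2 * delta * (beta * se + T.+1%:R * f xs).
  by field; rewrite !gt_eqF.
move: tele; move: (T.+1%:R) => n; nra.
Qed.

End biased_descent.

(** The telescoping halves the second moment, so that the left side has the coefficients 4, 1/2, 1/2
    and 2 where the right side has 32, 8, 4 and 4. The factor [N] in front of [tail] is gained from
    [N >= 1]. *)
Lemma error_terms_le (R : realType) (N K : nat)
    (alpha alpha_s B delta sigma L tail tail_s eta : R) :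
  (0 < N)%N -> (0 < K)%N -> 0 <= alpha -> 0 <= B -> 0 <= delta -> 0 <= L ->
  0 <= tail -> 0 <= tail_s -> 0 <= eta ->
  delta * (8 * B ^+ 2 * tail + alpha ^+ 2 * B ^+ 2 * L / N%:R +
    alpha_s ^+ 2 * alpha ^+ 2 * B ^+ 2 * L ^+ 2 / K%:R) / 2 +
  (2 * B * tail + 2 * (alpha * B * Num.sqrt L) * tail_s) * eta <=
  2 * sigma ^+ 2 * delta / N%:R +
  alpha ^+ 2 * B ^+ 2 * delta * (8 * L / N%:R + 4 * alpha_s ^+ 2 * L ^+ 2 / K%:R) +
  32 * B ^+ 2 * delta * (N%:R * tail + alpha ^+ 2 * L * tail_s) +
  4 * B * eta * (N%:R * tail + alpha * Num.sqrt L * tail_s).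
Proof.
move=> N1 K1 al0 B0 d0 L0 tail0 tail_s0 eta0.
have NN : (1 : R) <= N%:R by rewrite ler1n.
have tailN : tail <= N%:R * tail by rewrite ler_peMl.
have ab0 : 0 <= alpha ^+ 2 * B ^+ 2 * delta.
  by apply: mulr_ge0 => //; apply: mulr_ge0; exact: sqr_ge0.
have inv0 (n : nat) : 0 <= n%:R^-1 :> R by rewrite invr_ge0.
have s0 : 0 <= sigma ^+ 2 * delta / N%:R.
  by apply: mulr_ge0 => //; apply: mulr_ge0 => //; exact: sqr_ge0.
have p0 : 0 <= alpha ^+ 2 * B ^+ 2 * delta * L / N%:R.
  by apply: mulr_ge0 => //; exact: mulr_ge0.
have q0 : 0 <= alpha ^+ 2 * B ^+ 2 * delta * alpha_s ^+ 2 * L ^+ 2 / K%:R.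
  apply: mulr_ge0 => //; apply: mulr_ge0; last exact: sqr_ge0.
  by apply: mulr_ge0 => //; exact: sqr_ge0.
have r0 : 0 <= alpha ^+ 2 * L * tail_s.
  by apply: mulr_ge0 => //; apply: mulr_ge0 => //; exact: sqr_ge0.
have r1 : 0 <= alpha * Num.sqrt L * tail_s.
  by apply: mulr_ge0 => //; apply: mulr_ge0 => //; exact: sqrtr_ge0.
have b0 : 0 <= B ^+ 2 * delta by apply: mulr_ge0 => //; exact: sqr_ge0.
have second : 4 * (B ^+ 2 * delta) * tail <=
    32 * (B ^+ 2 * delta) * (N%:R * tail + alpha ^+ 2 * L * tail_s).
  have : (B ^+ 2 * delta) * tail <=
      (B ^+ 2 * delta) * (N%:R * tail + alpha ^+ 2 * L * tail_s).
    by rewrite ler_wpM2l//; lra.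
  have : 0 <= (B ^+ 2 * delta) * tail by rewrite mulr_ge0.
  lra.
have bias : (2 * B * tail + 2 * (alpha * B * Num.sqrt L) * tail_s) * eta <=
    4 * B * eta * (N%:R * tail + alpha * Num.sqrt L * tail_s).
  have -> : (2 * B * tail + 2 * (alpha * B * Num.sqrt L) * tail_s) * eta =
      (2 * B * eta) * (tail + alpha * Num.sqrt L * tail_s).
    by ring.
  have Be : 0 <= B * eta by exact: mulr_ge0.
  have : (B * eta) * (tail + alpha * Num.sqrt L * tail_s) <=
      (B * eta) * (N%:R * tail + alpha * Num.sqrt L * tail_s).
    by rewrite ler_wpM2l//; lra.
  have : 0 <= (B * eta) * (tail + alpha * Num.sqrt L * tail_s).
    by rewrite mulr_ge0//; lra.
  lra.
apply: lerD bias.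
have -> : delta * (8 * B ^+ 2 * tail + alpha ^+ 2 * B ^+ 2 * L / N%:R +
      alpha_s ^+ 2 * alpha ^+ 2 * B ^+ 2 * L ^+ 2 / K%:R) / 2 = 4 * (B ^+ 2 * delta) * tail
    + (alpha ^+ 2 * B ^+ 2 * delta * L / N%:R) / 2
    + (alpha ^+ 2 * B ^+ 2 * delta * alpha_s ^+ 2 * L ^+ 2 / K%:R) / 2.
  by field; rewrite !pnatr_eq0 -!lt0n N1 K1.
have -> : 2 * sigma ^+ 2 * delta / N%:R + alpha ^+ 2 * B ^+ 2 * delta *
      (8 * L / N%:R + 4 * alpha_s ^+ 2 * L ^+ 2 / K%:R) +
    32 * B ^+ 2 * delta * (N%:R * tail + alpha ^+ 2 * L * tail_s) =
    2 * (sigma ^+ 2 * delta / N%:R) + 8 * (alpha ^+ 2 * B ^+ 2 * delta * L / N%:R)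
    + 4 * (alpha ^+ 2 * B ^+ 2 * delta * alpha_s ^+ 2 * L ^+ 2 / K%:R)
    + 32 * (B ^+ 2 * delta) * (N%:R * tail + alpha ^+ 2 * L * tail_s).
  by ring.
move: second s0 p0 q0; move: (_ / N%:R) (_ / N%:R) (_ / K%:R) => s p q; lra.
Qed.

Theorem theorem5p5 (R : realType) :
  exists C : R, 2 <= C /\
  forall (d : nat) (H : 'M[R]_d) (N K T : nat) (delta : R)
    (f : 'cV[R]_d -> R)
    (dS : measure_display) (S : measurableType dS) (Q : probability S R)
    (dX : measure_display) (X : measurableType dX) (xi0 : {RV Q >-> X})
    (g : X -> 'cV[R]_d -> 'cV[R]_d) (sigma B alpha alpha_s : R)
    (dO : measure_display) (Omega : measurableType dO)
    (P : probability Omega R)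
    (xi : 'I_T.+1 -> 'I_N -> {RV P >-> X})
    (eps : 'I_T.+1 -> 'I_N -> {RV P >-> 'cV[R]_d})
    (tau : 'I_T.+1 -> 'I_N -> 'I_1 -> {RV P >-> 'cV[R]_d})
    (eps_s : 'I_T.+1 -> {RV P >-> 'cV[R]_d})
    (tau_s : 'I_T.+1 -> 'I_K -> {RV P >-> 'cV[R]_d})
    (x : nat -> Omega -> 'cV[R]_d) (x0 : 'cV[R]_d),
  let lam := alpha * B * Num.sqrt (ln d%:R / d%:R) in
  let lam_s := alpha_s * lam * Num.sqrt (ln d%:R) in
  (2 <= d)%N -> universal_sensing_basis H ->
  (1 <= N)%N -> (1 <= K)%N -> 0 < delta ->
  convex_function [set: 'cV[R]_d] f -> (forall y, differentiable f y) ->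
  stochastic_gradient_oracle xi0 g f ->
  variance_bounded xi0 g (sigma ^+ 2) ->
  0 < B -> (forall y, {ae Q, forall s, norm2 (g (xi0 s) y) <= B}) ->
  C <= alpha -> C <= alpha_s ->
  (forall t n, copy_of xi0 (xi t n)) ->
  (forall t n, uniform_signs (eps t n)) ->
  (forall t n k, uniform_cube lam (tau t n k)) ->
  (forall t, uniform_signs (eps_s t)) ->
  (forall t k, uniform_cube lam_s (tau_s t k)) ->
  all_independent xi eps tau eps_s tau_s ->
  (forall w, x 0%N w = x0) ->
  (forall (t : 'I_T.+1) w, x t.+1 w = x t w -
     delta *: descent_direction xi eps tau eps_s tau_s H lam lam_s g t w (x t w)) ->
  forall xstar : 'cV[R]_d,
  let eta : \bar R :=
    'E_P[fun w => (T.+1%:R^-1 * \sum_(t < T.+1) norm2 (x t w - xstar))%R]%E in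
  let Cterm : \bar R :=
    ((1 / (2 * T.+1%:R * delta) * norm2 (xstar - x0) ^+ 2)%:E
     + (delta / T.+1%:R)%:E
       * (\sum_(t < T.+1) 'E_P[fun w => (norm2 (gradient f (x t w)) ^+ 2)%R])
     + (2 * sigma ^+ 2 * delta / N%:R)%:E)%E in
  let L : R := ln d%:R in
  let tail : R := expR (- (alpha ^+ 2 * L / 8)) in
  let tail_s : R := expR (- (alpha_s ^+ 2 * L / 8)) in
  ('E_P[fun w => f (average_iterate T x w)] - (f xstar)%:E <=
     Cterm
     + (alpha ^+ 2 * B ^+ 2 * delta
        * (8 * L / N%:R + 4 * alpha_s ^+ 2 * L ^+ 2 / K%:R))%:E
     + (32 * B ^+ 2 * delta
        * (N%:R * tail + alpha ^+ 2 * L * tail_s))%:E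
     + (4 * B)%:E * eta
       * (N%:R * tail + alpha * Num.sqrt L * tail_s)%:E)%E.
Proof.
(* The value 3 is chosen because its square exceeds 8, which the absorption of the union bound into
   the exponent requires. *)
exists 3; split; first by lra.
move=> d H N K T delta f dS S Q dX X xi0 g sigma B alpha alpha_s dO Omega P.
move=> xi eps tau eps_s tau_s x x0 lam lam_s d2 [HHT Hflat] N1 K1 delta0 fconv fdiff.
move=> oracle _ B0 gB a3 as3 xic epsu tauu epssu tausu ind xinit xrec xstar.
cbv zeta; set L : R := ln d%:R; set tail := expR (- (alpha ^+ 2 * L / 8)).
set tail_s := expR (- (alpha_s ^+ 2 * L / 8)).
(* The abstract descent is indexed by all natural numbers, the sources by ['I_T.+1]. Beyond [T] the
   default of [inord] is index 0; the bounds for one step remain true there, and disjointness of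
   past and present is asked for only up to [T]. *)
pose V (t : nat) w y := coded_aggregate H g B alpha alpha_s xi eps tau eps_s tau_s
  (inord t) w w y.
pose u := iterate V x0 delta.
(* A common event of full measure for the finitely many sign vectors. On it the inverse matrices in
   the scheme are the rotations back, so [x] coincides with the measurable process [u]. *)
have [E [mE PE0 epsE]] : exists E : set Omega, [/\ measurable E, P (~` E) = 0%E &
    forall w, E w -> (forall t n j, eps t n w j 0 = 1 \/ eps t n w j 0 = -1) /\
      (forall t j, eps_s t w j 0 = 1 \/ eps_s t w j 0 = -1)].
  have ae_signs (e : {RV P >-> 'cV[R]_d}) : uniform_signs e ->
      {ae P, forall w, forall j, e w j 0 = 1 \/ e w j 0 = -1}.
    move=> /signs_almost_surely[D [mD PD0 hD]]; exists (~` D).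
    by split => //; [exact: measurableC|move=> w /= h /hD].
  have h1 : {ae P, forall w, forall t n j, eps t n w j 0 = 1 \/ eps t n w j 0 = -1}.
    by apply: filter_forall => t; apply: filter_forall => n; exact: ae_signs.
  have h2 : {ae P, forall w, forall t j, eps_s t w j 0 = 1 \/ eps_s t w j 0 = -1}.
    by apply: filter_forall => t; exact: ae_signs.
  have [Z [mZ PZ subZ]] := filterI h1 h2.
  exists (~` Z); rewrite setCK; split => //; first exact: measurableC.
  by move=> w nZ; apply: contrapT => /subZ.
have xu t w : E w -> (t <= T.+1)%N -> x t w = u t w.
  move=> Ew; elim: t => [_|t ih tT]; first exact: xinit.
  have tE : nat_of_ord (inord t : 'I_T.+1) = t by rewrite inordK.
  have := xrec (inord t) w; rewrite tE => ->; rewrite ih ?(ltnW tT)//=.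
  have [he hs] := epsE _ Ew.
  congr (_ - delta *: _); rewrite /descent_direction (transformE HHT); last exact: hs.
  rewrite /V /coded_aggregate /aggregate; congr (sign_transform _ _ _ _ (_ *: _)).
  by apply: eq_bigr => n _; exact: (transformE HHT).
have B_s0 : 0 <= alpha * B * Num.sqrt L.
  by rewrite !mulr_ge0 ?sqrtr_ge0 ?ltW//; lra.
have D0 : 0 <= alpha_s * (alpha * B * Num.sqrt L) * Num.sqrt L.
  by rewrite mulr_ge0 ?sqrtr_ge0// mulr_ge0//; lra.
have tA (t : nat) : (t <= T)%N -> nat_of_ord (inord t : 'I_T.+1) = t.
  by move=> tT; rewrite inordK.
have sF := source_sigma_algebra xi eps tau eps_s tau_s.
have mF := @source_sigma_measurable _ _ _ _ _ _ _ _ _ P xi eps tau eps_s tau_s.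
(* The first worker at time 0 serves as the copy of the oracle whose mean is the gradient; it exists
   because [N >= 1]. *)
have grad_le y : norm2 (gradient f y) <= B.
  exact: (norm2_gradient_le (xic ord0 (Ordinal N1)) oracle (ltW B0) (gB y)).
have disj t : (t <= T)%N ->
    @sources_before T N K t `&` sources_at (inord t) = set0.
  move=> tT; apply/seteqP; split => // s [/= + st].
  by rewrite /sources_before/= st tA// ltnn.
have incl t : (t <= T)%N -> @sources_before T N K t `<=` sources_before t.+1.
  by move=> tT s; rewrite /sources_before/= => /ltnW.
have incl' t : (t <= T)%N -> @sources_at T N K (inord t) `<=` sources_before t.+1.
  by move=> tT s; rewrite /sources_before/= => ->; rewrite tA.
have mV t J dA (A : measurableType dA) (om : A -> Omega) (h : A -> 'cV[R]_d) :
    sources_at (inord t) `<=` J ->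
    measurable_fun [set: A] (om : A -> g_sigma_algebraType
      (union_sigma (source_sigma xi eps tau eps_s tau_s) J)) ->
    measurable_fun [set: A] h -> measurable_fun [set: A] (fun a => V t (om a) (h a)).
  move=> sJ mom mh.
  apply: (measurable_coded_aggregate _ _ _ _ oracle mom mom mh) => s [+ _]; exact: sJ.
pose beta := 2 * B * tail + 2 * (alpha * B * Num.sqrt L) * tail_s.
pose M := 8 * B ^+ 2 * tail + alpha ^+ 2 * B ^+ 2 * L / N%:R +
  alpha_s ^+ 2 * alpha ^+ 2 * B ^+ 2 * L ^+ 2 / K%:R.
have bV t w y : norm2 (V t w y) <= alpha_s * (alpha * B * Num.sqrt L) * Num.sqrt L.
  exact: norm2_coded_aggregate_le.
have biasV t y c : `|mean P (fun w => dot (V t w y) c) - dot (gradient f y) c| <=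
    beta * norm2 c.
  exact: (coded_aggregate_bias d2 HHT Hflat N1 K1 oracle B0 gB a3 as3).
have sqrV t y : mean P (fun w => dot (V t w y) (V t w y)) <=
    2 * norm2 (gradient f y) ^+ 2 + M.
  rewrite /M !addrA.
  exact: (mean_coded_aggregate_sqr d2 HHT Hflat N1 K1 oracle B0 gB a3 as3).
have desc := biased_descent sF mF ind x0 disj incl incl' delta0 (ltW B0) D0 mV bV biasV sqrV
  fconv fdiff grad_le xstar.
have T0 : (0 : R) < T.+1%:R by [].
have tT1 (t : 'I_T.+1) : (t <= T.+1)%N by rewrite ltnW.
have modify (a b : Omega -> R) : bounded_measurable b -> (forall w, E w -> a w = b w) ->
    ('E_P[a] = (mean P b)%:E)%E.
  by move=> bb ab; rewrite (expectation_null_modification mE PE0 ab) expectation_mean.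
have -> : ('E_P[fun w => f (average_iterate T x w)] =
    (mean P (fun w => f (average_iterate T u w)))%:E)%E.
  apply: modify.
    exact: (bounded_measurable_average mF x0 incl incl' delta0 (ltW B0) D0 mV bV fconv fdiff
      grad_le xstar).
  move=> w Ew; congr (f (_ *: _)); apply: eq_bigr => t _; exact: xu.
have -> : ('E_P[fun w => (T.+1%:R^-1 * \sum_(t < T.+1) norm2 (x t w - xstar))%R] =
    (mean P (fun w => T.+1%:R^-1 * \sum_(t < T.+1) norm2 (u t w - xstar)))%:E)%E.
  apply: modify.
    apply: bounded_measurableM; first exact: bounded_measurable_cst.
    apply: bounded_measurable_sum => t.
    exact: (bounded_measurable_distance mF x0 incl incl' delta0 mV bV xstar (tT1 t)).
  by move=> w Ew; congr (_ * _); apply: eq_bigr => t _; rewrite xu.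
have eG (t : 'I_T.+1) : ('E_P[fun w => (norm2 (gradient f (x t w)) ^+ 2)%R] =
    (mean P (fun w => norm2 (gradient f (u t w)) ^+ 2))%:E)%E.
  apply: modify.
    exact: (bounded_measurable_gradient_sqr mF x0 delta incl incl' (ltW B0) mV fdiff grad_le (tT1 t)).
  by move=> w Ew; rewrite xu.
under eq_bigr do rewrite eG.
rewrite sumEFin.
rewrite -EFinB -!EFinM -!EFinD lee_fin.
have tail0 : 0 <= tail by exact: expR_ge0.
have tail_s0 : 0 <= tail_s by exact: expR_ge0.
set eta := mean P (fun w => T.+1%:R^-1 * _).
have eta0 : 0 <= eta.
  apply: Rintegral_ge0 => w _; rewrite mulr_ge0// sumr_ge0// => t _.
  exact: norm2_ge0.
apply: (le_trans desc); rewrite -/u -/eta -!addrA !lerD2l !addrA.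
by apply: error_terms_le => //; [lra|exact: ltW|exact: ltW|exact/ltW/ln_nat_gt0].
Qed.
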